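(* Let $\mathcal{P}=He_1\oplus He_2$ be the free left $H$-module of rank two with basis $e_1,e_2$, equipped with an $H$-pseudoalgebra structure such that $e_{1}\ast e_{1}=0$ and $e_{2}\ast e_{2}=0$ (and $e_1\ast e_2$, $e_2\ast e_1$ are arbitrary elements of $(H\otimes H)\otimes_H\mathcal{P}$). Then $\mathcal{P}$ is associative if and only if $e_{1}\ast e_{2}=e_{2}\ast e_{1}=0$.
   Context: $\mathbf{k}$ is an algebraically closed field of characteristic $0$, $\delta$ is a finite-dimensional Lie algebra over $\mathbf{k}$, and $H=U(\delta)$ is its universal enveloping algebra with the standard cocommutative Hopf structure ($\Delta(x)=x\otimes1+1\otimes x$ for $x\in\delta$). We regard $\mathbf{k},\delta\subset H$. $H^{\otimes n}$ is a right $H$-module via the iterated coproduct, e.g. $(f\otimes g)\cdot h=(f\otimes g)\Delta(h)$. An $H$-pseudoalgebra is a left $H$-module $A$ with a map $\ast:A\otimes A\to(H\otimes H)\otimes_H A$ that is $H$-bilinear: $hx\ast gy=(h\otimes g\otimes_H1)(x\ast y)$ for $x,y\in A$, $h,g\in H$. For $\beta\in H\otimes H$ and $x\ast y=\sum_i\alpha_i\otimes_Hc_i$ one sets, in $H^{\otimes3}\otimes_HA$, $(\beta\otimes_Hx)\ast y=\sum_i(\beta\otimes1)(\Delta\otimes\mathrm{id})(\alpha_i)\otimes_Hc_i$ and $x\ast(\beta\otimes_Hy)=\sum_i(1\otimes\beta)(\mathrm{id}\otimes\Delta)(\alpha_i)\otimes_Hc_i$. $A$ is associative if $(x\ast y)\ast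 z=x\ast(y\ast z)$ for all $x,y,z\in A$. By $H$-bilinearity a pseudoproduct on a free module is determined by its values on basis elements. *)

(* Defs.v *)
From HB Require Import structures.
From mathcomp Require Import all_boot all_order all_algebra.
From mathcomp Require Import boolp.

Set Implicit Arguments.
Unset Strict Implicit.
Unset Printing Implicit Defensive.

Import GRing.Theory.
Local Open Scope ring_scope.
Local Open Scope quotient_scope.

(* [vectType] makes the Lie algebras finite-dimensional. *)
HB.mixin Record Vector_isLie (k : fieldType) L of Vector k L := {
  lie : L -> L -> L;
  lie_linearl : forall y, linear (lie^~ y);
  lie_linearr : forall x, linear (lie x);
  liexx : forall x, lie x x = 0;
  lie_jacobi : forall x y z,
    lie x (lie y z) + lie y (lie z x) + lie z (lie x y) = 0
}.

#[short(type="lieAlgType")]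
HB.structure Definition LieAlgebra (k : fieldType) :=
  {L of Vector k L & Vector_isLie k L}.

(* The augmentation is the counit of the bialgebras below; it also shows that a
   tensor product of algebras is a nonzero ring, as [algType] requires. *)
HB.mixin Record Algebra_hasAugmentation (k : fieldType) A
    of GRing.Algebra k A := {
  augm : A -> k;
  augmD : {morph augm : x y / x + y};
  augmZ : forall c x, augm (c *: x) = c * augm x;
  augm1 : augm 1 = 1;
  augmM : {morph augm : x y / x * y}
}.

#[short(type="augAlgType")]
HB.structure Definition AugAlgebra (k : fieldType) :=
  {A of GRing.Algebra k A & Algebra_hasAugmentation k A}.

Section Tensor.
Variables (R : pzRingType) (M : zmodType) (act : M -> R -> M) (N : lmodType R).
Implicit Types s t u : seq (M * N).

(* A finite sequence of pairs stands for the formal sum of its members. *)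
Inductive tens_rel : seq (M * N) -> seq (M * N) -> Prop :=
| Tens_refl s : tens_rel s s
| Tens_sym s t : tens_rel s t -> tens_rel t s
| Tens_trans t s u : tens_rel s t -> tens_rel t u -> tens_rel s u
| Tens_cat s s' t t' :
    tens_rel s s' -> tens_rel t t' -> tens_rel (s ++ t) (s' ++ t')
| Tens_catC s t : tens_rel (s ++ t) (t ++ s)
| Tens_0l n : tens_rel [:: (0, n)] [::]
| Tens_Dl m m' n : tens_rel [:: (m + m', n)] [:: (m, n); (m', n)]
| Tens_Dr m n n' : tens_rel [:: (m, n + n')] [:: (m, n); (m, n')]
| Tens_bal m r n : tens_rel [:: (act m r, n)] [:: (m, r *: n)].

Definition tens_relb s t := `[< tens_rel s t >].

Lemma tens_relb_refl : reflexive tens_relb.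
Proof. by move=> s; apply/asboolP; apply: Tens_refl. Qed.

Lemma tens_relb_sym : symmetric tens_relb.
Proof. by move=> s t; apply: asbool_equiv_eq; split; apply: Tens_sym. Qed.

Lemma tens_relb_trans : transitive tens_relb.
Proof.
move=> t s u /asboolP st /asboolP tu; apply/asboolP.
exact: Tens_trans st tu.
Qed.

Definition tens_equiv :=
  EquivRel tens_relb tens_relb_refl tens_relb_sym tens_relb_trans.

Definition tens := {eq_quot tens_equiv}.
HB.instance Definition _ : EqQuotient _ tens_equiv tens := EqQuotient.on tens.
HB.instance Definition _ := Choice.on tens.

Lemma tens_piP s t : reflect (tens_rel s t) (\pi_tens s == \pi_tens t).
Proof. by rewrite eqmodE; apply: asboolP. Qed.

Lemma tens_pi_eq s t : tens_rel s t -> \pi_tens s = \pi_tens t.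
Proof. by move=> /tens_piP/eqP. Qed.

Lemma tens_reprK s : tens_rel (repr (\pi_tens s)) s.
Proof. by apply/tens_piP; rewrite reprK. Qed.

Definition tens_zero : tens := \pi_tens [::].
Definition tens_add (x y : tens) : tens := \pi_tens (repr x ++ repr y).
Definition tens_opp (x : tens) : tens :=
  \pi_tens [seq (- p.1, p.2) | p <- repr x].

Lemma tens_surj (x : tens) : exists s, x = \pi_tens s.
Proof. by exists (repr x); rewrite reprK. Qed.

Lemma tens_add_pi s t : tens_add (\pi_tens s) (\pi_tens t) = \pi_tens (s ++ t).
Proof. by apply: tens_pi_eq; apply: Tens_cat; apply: tens_reprK. Qed.

Lemma tens_addA : associative tens_add.
Proof.
move=> x y z.
case: (tens_surj x) (tens_surj y) (tens_surj z) => s -> [t ->] [u ->].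
by rewrite (tens_add_pi t u) (tens_add_pi s t) !tens_add_pi catA.
Qed.

Lemma tens_addC : commutative tens_add.
Proof. by move=> x y; apply: tens_pi_eq; apply: Tens_catC. Qed.

Lemma tens_add0 : left_id tens_zero tens_add.
Proof. by move=> x; case: (tens_surj x) => s ->; apply: tens_add_pi. Qed.

Lemma tens_addN : left_inverse tens_zero tens_opp tens_add.
Proof.
move=> x; rewrite -[in X in tens_add _ X](reprK x) tens_add_pi.
apply: tens_pi_eq; elim: (repr x) => [|[m n] s IHs] /=; first exact: Tens_refl.
rewrite -cat1s -[(m, n) :: s]cat1s.
apply: (@Tens_trans ([:: (- m, n)] ++
   ([:: (m, n)] ++ [seq (- p.1, p.2) | p <- s] ++ s))).
  apply: Tens_cat; first exact: Tens_refl.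
  rewrite !catA; apply: Tens_cat; last exact: Tens_refl.
  exact: Tens_catC.
rewrite catA -[X in tens_rel _ X]cats0.
apply: Tens_trans (Tens_cat (Tens_refl _) IHs) _; rewrite !cats0.
apply: Tens_trans (Tens_sym (Tens_Dl _ _ _)) _.
by rewrite addNr; apply: Tens_0l.
Qed.

HB.instance Definition _ :=
  GRing.isZmodule.Build tens tens_addA tens_addC tens_add0 tens_addN.

Definition pure (m : M) (n : N) : tens := \pi_tens [:: (m, n)].

Lemma tens_sum_pi s : \pi_tens s = \sum_(p <- s) pure p.1 p.2.
Proof.
elim: s => [|[m n] s IHs]; first by rewrite big_nil.
by rewrite big_cons -IHs -cat1s -tens_add_pi.
Qed.

Lemma tensE x : x = \sum_(p <- repr x) pure p.1 p.2.
Proof. by rewrite -tens_sum_pi reprK. Qed.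

Lemma pureDl m m' n : pure (m + m') n = pure m n + pure m' n.
Proof.
rewrite /pure (tens_pi_eq (Tens_Dl m m' n)) tens_sum_pi.
by rewrite big_cons big_seq1.
Qed.

Lemma pureDr m n n' : pure m (n + n') = pure m n + pure m n'.
Proof.
rewrite /pure (tens_pi_eq (Tens_Dr m n n')) tens_sum_pi.
by rewrite big_cons big_seq1.
Qed.

Lemma pure_bal m r n : pure (act m r) n = pure m (r *: n).
Proof. apply: tens_pi_eq; exact: Tens_bal. Qed.

Lemma tens_ext (V : zmodType) (f g : tens -> V) :
  {morph f : x y / x + y} -> {morph g : x y / x + y} ->
  (forall m n, f (pure m n) = g (pure m n)) -> f =1 g.
Proof.
move=> fD gD fg x; rewrite (tensE x).
have h0 (h : tens -> V) : {morph h : x y / x + y} -> h 0 = 0.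
  by move=> hD; apply: (addrI (h 0)); rewrite -hD !addr0.
rewrite (big_morph f fD (h0 _ fD)) (big_morph g gD (h0 _ gD)).
by apply: eq_bigr => p _.
Qed.

Record balanced (V : zmodType) (f : M -> N -> V) : Prop := Balanced {
  balDl : forall m m' n, f (m + m') n = f m n + f m' n;
  balDr : forall m n n', f m (n + n') = f m n + f m n';
  balA : forall m r n, f (act m r) n = f m (r *: n) }.

(* The additive map with m (x) n |-> f m n when f is balanced, see
   [tlift_pure] and [tliftD]; of no significance for other f. *)
Definition tlift (V : zmodType) (f : M -> N -> V) (x : tens) : V :=
  \sum_(p <- repr x) f p.1 p.2.

Section Lift.
Variables (V : zmodType) (f : M -> N -> V) (fb : balanced f).

Lemma tlift_pi s : tlift f (\pi_tens s) = \sum_(p <- s) f p.1 p.2.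
Proof.
case: fb => fDl fDr fA; rewrite /tlift.
have f0 n : f 0 n = 0 by apply: (addrI (f 0 n)); rewrite -fDl !addr0.
have rel t u : tens_rel t u ->
    \sum_(p <- t) f p.1 p.2 = \sum_(p <- u) f p.1 p.2;
    last exact: rel (tens_reprK s).
elim=> // {s t u} [t u v _ -> _ -> //
  |t t' u u' _ IHt _ IHu|t u|n|m m' n|m n n'|m r n].
- by rewrite !big_cat /= IHt IHu.
- by rewrite !big_cat /= addrC.
- by rewrite big_nil big_seq1 f0.
- by rewrite !big_cons !big_nil !addr0 fDl.
- by rewrite !big_cons !big_nil !addr0 fDr.
- by rewrite !big_seq1 fA.
Qed.

Lemma tlift_pure m n : tlift f (pure m n) = f m n.
Proof. by rewrite tlift_pi big_seq1. Qed.

Lemma tliftD : {morph tlift f : x y / x + y}.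
Proof.
move=> x y; rewrite -[x]reprK -[y]reprK.
have -> : \pi_tens (repr x) + \pi_tens (repr y) =
  \pi_tens (repr x ++ repr y) by exact: tens_add_pi.
by rewrite !tlift_pi big_cat.
Qed.

End Lift.

End Tensor.

Lemma add_fun_morph (U V : zmodType) (f g : U -> V) :
  {morph f : x y / x + y} -> {morph g : x y / x + y} ->
  {morph (fun u => f u + g u) : x y / x + y}.
Proof. by move=> fD gD x y; rewrite fD gD addrACA. Qed.

Lemma add_comp_morph (U V W : zmodType) (f : V -> W) (g : U -> V) :
  {morph f : x y / x + y} -> {morph g : x y / x + y} ->
  {morph (fun u => f (g u)) : x y / x + y}.
Proof. by move=> fD gD x y; rewrite gD fD. Qed.

Definition tensk (k : fieldType) (A B : lmodType k) :=
  tens (fun (a : A) (c : k) => c *: a) B.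

HB.instance Definition _ (k : fieldType) (A B : lmodType k) :=
  GRing.Zmodule.on (tensk A B).

Definition purek (k : fieldType) (A B : lmodType k) (a : A) (b : B) :
  tensk A B := pure _ a b.

Definition tliftk (k : fieldType) (A B : lmodType k) (V : zmodType)
  (f : A -> B -> V) : tensk A B -> V := tlift f.

Section TensorField.
Variables (k : fieldType) (A B : lmodType k).

Lemma purekDl (a a' : A) (b : B) : purek (a + a') b = purek a b + purek a' b.
Proof. exact: pureDl. Qed.

Lemma purekDr (a : A) (b b' : B) : purek a (b + b') = purek a b + purek a b'.
Proof. exact: pureDr. Qed.

Lemma purekZ (a : A) c (b : B) : purek (c *: a) b = purek a (c *: b).
Proof. exact: (pure_bal (fun (a : A) (c : k) => c *: a)). Qed.

Lemma tensk_ext (V : zmodType) (f g : tensk A B -> V) :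
  {morph f : x y / x + y} -> {morph g : x y / x + y} ->
  (forall a b, f (purek a b) = g (purek a b)) -> f =1 g.
Proof. exact: tens_ext. Qed.

Lemma balancedk (V : zmodType) (f : A -> B -> V) :
  (forall b a a', f (a + a') b = f a b + f a' b) ->
  (forall a b b', f a (b + b') = f a b + f a b') ->
  (forall c a b, f (c *: a) b = f a (c *: b)) ->
  balanced (fun (a : A) (c : k) => c *: a) f.
Proof. by move=> fDl fDr fZ; split=> *; [apply: fDl|apply: fDr|apply: fZ]. Qed.

Lemma tliftk_pure (V : zmodType) (f : A -> B -> V) a b :
  balanced (fun (a : A) (c : k) => c *: a) f -> tliftk f (purek a b) = f a b.
Proof. by move=> fb; apply: tlift_pure. Qed.

Lemma tliftkD (V : zmodType) (f : A -> B -> V) :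
  balanced (fun (a : A) (c : k) => c *: a) f -> {morph tliftk f : x y / x + y}.
Proof. exact: tliftD. Qed.

Definition tensk_scale (c : k) : tensk A B -> tensk A B :=
  tliftk (fun a b => purek (c *: a) b).

Lemma tensk_scale_bal c :
  balanced (fun (a : A) (c : k) => c *: a)
    (fun a (b : B) => purek (c *: a) b).
Proof.
by split=> *; rewrite ?scalerDr ?purekDl ?purekDr // scalerA mulrC -scalerA purekZ.
Qed.

Lemma tensk_scale_pure c a b : tensk_scale c (purek a b) = purek (c *: a) b.
Proof. by apply: tliftk_pure; apply: tensk_scale_bal. Qed.

Lemma tensk_scaleD c : {morph tensk_scale c : x y / x + y}.
Proof. by apply: tliftkD; apply: tensk_scale_bal. Qed.

Lemma tensk_scaleA c d x :
  tensk_scale c (tensk_scale d x) = tensk_scale (c * d) x.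
Proof.
move: x; apply: tensk_ext => [||a b].
- exact: add_comp_morph (tensk_scaleD _) (tensk_scaleD _).
- exact: tensk_scaleD.
- by rewrite !tensk_scale_pure scalerA.
Qed.

Lemma tensk_scale1 : left_id 1 tensk_scale.
Proof.
apply: tensk_ext => // [|a b]; first exact: tensk_scaleD.
by rewrite tensk_scale_pure scale1r.
Qed.

Lemma tensk_scaleDl x : {morph tensk_scale^~ x : c d / c + d}.
Proof.
move=> c d; move: x; apply: tensk_ext => [||a b].
- exact: tensk_scaleD.
- exact: add_fun_morph (tensk_scaleD _) (tensk_scaleD _).
- by rewrite !tensk_scale_pure scalerDl purekDl.
Qed.

HB.instance Definition _ := GRing.Zmodule_isLmodule.Build k (tensk A B)
  tensk_scaleA tensk_scale1 tensk_scaleD tensk_scaleDl.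

Lemma scale_purek c (a : A) (b : B) : c *: purek a b = purek (c *: a) b.
Proof. exact: tensk_scale_pure. Qed.

End TensorField.

Section TensorMap.
Variables (k : fieldType) (A B A' B' C : lmodType k).

Definition tmap (f : A -> A') (g : B -> B') : tensk A B -> tensk A' B' :=
  tliftk (fun a b => purek (f a) (g b)).

Section TMap.
Variables (f : {linear A -> A'}) (g : {linear B -> B'}).

Let tmap_bal : balanced (fun (a : A) (c : k) => c *: a)
  (fun a b => purek (f a) (g b)).
Proof.
apply: balancedk => * /=; rewrite ?linearD ?purekDl ?purekDr //.
by rewrite !linearZ_LR purekZ.
Qed.

Lemma tmap_pure a b : tmap f g (purek a b) = purek (f a) (g b).
Proof. exact: tliftk_pure. Qed.

Lemma tmapD : {morph tmap f g : x y / x + y}.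
Proof. exact: tliftkD. Qed.

End TMap.

Definition tassoc : tensk A (tensk B C) -> tensk (tensk A B) C :=
  tliftk (fun (a : A) => tliftk (fun b c => purek (purek a b) c)).

Let tassoc_bal1 (a : A) : balanced (fun (b : B) (c : k) => c *: b)
  (fun b (c : C) => purek (purek a b) c).
Proof.
apply: balancedk => * /=; rewrite ?purekDr ?purekDl //.
by rewrite -purekZ -scale_purek purekZ.
Qed.

Let tassoc_bal : balanced (fun (a : A) (c : k) => c *: a)
  (fun a (x : tensk B C) => tliftk (fun b c => purek (purek a b) c) x).
Proof.
apply: balancedk => [x a a'|a x y|c a x]; last 1 first.
- move: x; apply: tensk_ext => [||b d].
  + by apply: tliftkD.
  + move=> x y; rewrite scalerDr; exact: tliftkD.
  + by rewrite scale_purek !tliftk_pure // purekZ.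
- move: x; apply: tensk_ext => [||b d].
  + by apply: tliftkD.
  + by apply: add_fun_morph; apply: tliftkD.
  + by rewrite !tliftk_pure // !purekDl.
- exact: tliftkD.
Qed.

Lemma tassoc_pure a b c :
  tassoc (purek a (purek b c)) = purek (purek a b) c.
Proof.
rewrite /tassoc (tliftk_pure _ _ tassoc_bal); exact: tliftk_pure.
Qed.

Lemma tassocD : {morph tassoc : x y / x + y}.
Proof. exact: tliftkD. Qed.

End TensorMap.

Section TensorAlgebra.
Variables (k : fieldType) (A B : augAlgType k).
Local Notation AB := (tensk A B).

Definition tensk_mul (x y : AB) : AB :=
  tliftk (fun a b => tliftk (fun a' b' => purek (a * a') (b * b')) y) x.

Let mul_bal1 (a : A) (b : B) : balanced (fun (a : A) (c : k) => c *: a)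
  (fun a' b' => purek (a * a') (b * b')).
Proof.
apply: balancedk => * /=; rewrite ?mulrDr ?purekDl ?purekDr //.
by rewrite -!scalerAr purekZ.
Qed.

Let mul_bal y : balanced (fun (a : A) (c : k) => c *: a)
  (fun a (b : B) => tliftk (fun a' b' => purek (a * a') (b * b')) y).
Proof.
apply: balancedk => [b a a'|a b b'|c a b]; move: y; apply: tensk_ext => *;
  try by apply: tliftkD.
- by apply: add_fun_morph; apply: tliftkD.
- by rewrite !tliftk_pure // mulrDl purekDl.
- by apply: add_fun_morph; apply: tliftkD.
- by rewrite !tliftk_pure // mulrDl purekDr.
- by rewrite !tliftk_pure // -!scalerAl purekZ.
Qed.

Lemma tensk_mul_pure a b a' b' :
  tensk_mul (purek a b) (purek a' b') = purek (a * a') (b * b').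
Proof. by rewrite /tensk_mul (tliftk_pure _ _ (mul_bal _)) tliftk_pure. Qed.

Lemma tensk_mulDl : left_distributive tensk_mul +%R.
Proof. by move=> x y z; apply: tliftkD. Qed.

Lemma tensk_mulDr : right_distributive tensk_mul +%R.
Proof.
move=> x y z; move: x; apply: tensk_ext => [||a b].
- by move=> x y'; apply: tensk_mulDl.
- by apply: add_fun_morph => x y'; apply: tensk_mulDl.
- by rewrite /tensk_mul !(tliftk_pure _ _ (mul_bal _)) tliftkD.
Qed.

Lemma tensk_mulA : associative tensk_mul.
Proof.
have Dl z : {morph tensk_mul^~ z : x y / x + y} by move=> *; apply: tensk_mulDl.
have Dr z : {morph tensk_mul z : x y / x + y} by move=> *; apply: tensk_mulDr.
move=> x y z; move: x.
apply: tensk_ext => [||a b]; first exact: Dl.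
  exact: add_comp_morph (Dl _) (Dl _).
move: y; apply: tensk_ext => [||a' b'].
- exact: add_comp_morph (Dr _) (Dl _).
- exact: add_comp_morph (Dl _) (Dr _).
move: z; apply: tensk_ext => [||a'' b''].
- exact: add_comp_morph (Dr _) (Dr _).
- exact: Dr.
by rewrite !tensk_mul_pure !mulrA.
Qed.

Lemma tensk_mul1l : left_id (purek 1 1) tensk_mul.
Proof.
apply: tensk_ext => // [x y|a b]; first exact: tensk_mulDr.
by rewrite tensk_mul_pure !mul1r.
Qed.

Lemma tensk_mul1r : right_id (purek 1 1) tensk_mul.
Proof.
apply: tensk_ext => // [x y|a b]; first exact: tensk_mulDl.
by rewrite tensk_mul_pure !mulr1.
Qed.

HB.instance Definition _ := GRing.Zmodule_isPzRing.Build AB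
  tensk_mulA tensk_mul1l tensk_mul1r tensk_mulDl tensk_mulDr.

Definition tensk_augm : AB -> k := tliftk (fun a b => augm a * augm b).

Let augm_bal : balanced (fun (a : A) (c : k) => c *: a)
  (fun a (b : B) => augm a * augm b).
Proof.
apply: balancedk => *; rewrite /= ?augmD ?mulrDl ?mulrDr //.
by rewrite !augmZ mulrCA mulrA.
Qed.

Lemma tensk_augm_pure a b : tensk_augm (purek a b) = augm a * augm b.
Proof. exact: tliftk_pure. Qed.

Lemma tensk_augmD : {morph tensk_augm : x y / x + y}.
Proof. exact: tliftkD. Qed.

Lemma tensk_augm1 : tensk_augm 1 = 1.
Proof. by rewrite tensk_augm_pure !augm1 mulr1. Qed.

Lemma tensk_1_neq0 : (1 : AB) != 0.
Proof.
apply/eqP => e; have := tensk_augm1; rewrite e => /eqP.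
have -> : tensk_augm 0 = 0.
  by apply: (addrI (tensk_augm 0)); rewrite -tensk_augmD !addr0.
by rewrite eq_sym oner_eq0.
Qed.

HB.instance Definition _ := GRing.PzSemiRing_isNonZero.Build AB tensk_1_neq0.

Lemma purekM (a a' : A) (b b' : B) :
  purek a b * purek a' b' = purek (a * a') (b * b') :> AB.
Proof. exact: tensk_mul_pure. Qed.

Lemma tensk_scaleAl (c : k) (x y : AB) : c *: (x * y) = (c *: x) * y.
Proof.
move: x; apply: tensk_ext => [x x'|x x'|a b]; rewrite ?mulrDl ?scalerDr ?mulrDl //.
move: y; apply: tensk_ext => [x x'|x x'|a' b']; rewrite ?mulrDr ?scalerDr //.
by rewrite !(scale_purek, purekM) scalerAl.
Qed.

HB.instance Definition _ := GRing.Lmodule_isLalgebra.Build k AB tensk_scaleAl.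

Lemma tensk_scaleAr (c : k) (x y : AB) : c *: (x * y) = x * (c *: y).
Proof.
move: x; apply: tensk_ext => [x x'|x x'|a b]; rewrite ?mulrDl ?scalerDr ?mulrDl //.
move: y; apply: tensk_ext => [x x'|x x'|a' b']; rewrite ?mulrDr ?scalerDr ?mulrDr //.
by rewrite !(scale_purek, purekM) scalerAr.
Qed.

HB.instance Definition _ := GRing.Lalgebra_isAlgebra.Build k AB tensk_scaleAr.

Lemma tensk_augmZ c x : tensk_augm (c *: x) = c * tensk_augm x.
Proof.
move: x; apply: tensk_ext => [x y|x y|a b]; rewrite ?scalerDr ?tensk_augmD ?mulrDr //.
by rewrite scale_purek !tensk_augm_pure augmZ mulrA.
Qed.

Lemma tensk_augmM : {morph tensk_augm : x y / x * y}.
Proof.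
move=> x y; move: x; apply: tensk_ext => [x x'|x x'|a b];
  rewrite ?mulrDl ?tensk_augmD ?mulrDl //.
move: y; apply: tensk_ext => [x x'|x x'|a' b'];
  rewrite ?mulrDr ?tensk_augmD ?mulrDr //.
by rewrite purekM !tensk_augm_pure !augmM mulrACA.
Qed.

HB.instance Definition _ := Algebra_hasAugmentation.Build k AB
  tensk_augmD tensk_augmZ tensk_augm1 tensk_augmM.

End TensorAlgebra.

Section TensorAlgebraMap.
Variables (k : fieldType) (A B C A' B' : augAlgType k).

Lemma tmapM (f : {lrmorphism A -> A'}) (g : {lrmorphism B -> B'}) :
  {morph tmap f g : x y / x * y}.
Proof.
move=> x y; move: x; apply: tensk_ext => [x x'|x x'|a b];
  rewrite ?mulrDl ?tmapD ?mulrDl //.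
move: y; apply: tensk_ext => [x x'|x x'|a' b'];
  rewrite ?mulrDr ?tmapD ?mulrDr //.
by rewrite purekM !tmap_pure purekM !rmorphM.
Qed.

Lemma tassocM : {morph @tassoc k A B C : x y / x * y}.
Proof.
have Ml (T : algType k) (z : T) : {morph *%R^~ z : x y / x + y}.
  by move=> *; apply: mulrDl.
have Mr (T : algType k) (z : T) : {morph *%R z : x y / x + y}.
  by move=> *; apply: mulrDr.
have tD := @tassocD k A B C.
have pD (a : A) : {morph (fun x : tensk B C => purek a x) : x y / x + y}.
  by move=> y z; apply: (@purekDr k A (tensk B C) a).
move=> x y; move: x; apply: tensk_ext.
- exact: add_comp_morph tD (Ml _ _).
- exact: add_comp_morph (Ml _ _) tD.
move=> a; apply: tensk_ext.
- exact: add_comp_morph (add_comp_morph tD (Ml _ _)) (pD a).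
- exact: add_comp_morph (add_comp_morph (Ml _ _) tD) (pD a).
move=> b c; move: y; apply: tensk_ext.
- exact: add_comp_morph tD (Mr _ _).
- exact: add_comp_morph (Mr _ _) tD.
move=> a'; apply: tensk_ext.
- exact: add_comp_morph (add_comp_morph tD (Mr _ _)) (pD a').
- exact: add_comp_morph (add_comp_morph (Mr _ _) tD) (pD a').
move=> b' c'; rewrite (@purekM k A (tensk B C)) (@purekM k B C).
rewrite !tassoc_pure (@purekM k (tensk A B) C); congr (purek _ _).
by rewrite (@purekM k A B).
Qed.

End TensorAlgebraMap.

(* [augm] is the counit. *)
HB.mixin Record AugAlgebra_isBialgebra (k : fieldType) H
    of AugAlgebra k H := {
  coprod : H -> tensk H H;
  coprod_linear : linear coprod;
  coprod_monoid_morphism : monoid_morphism coprod;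
  coprod_coassoc : forall h,
    tmap coprod idfun (coprod h) = tassoc (tmap idfun coprod (coprod h));
  coprod_counitl : forall h, tliftk (fun a b => augm a *: b) (coprod h) = h;
  coprod_counitr : forall h, tliftk (fun a b => augm b *: a) (coprod h) = h
}.

#[short(type="bialgType")]
HB.structure Definition Bialgebra (k : fieldType) :=
  {H of AugAlgebra k H & AugAlgebra_isBialgebra k H}.

HB.instance Definition _ (k : fieldType) (H : bialgType k) :=
  GRing.isLinear.Build k H (tensk H H) _ (@coprod k H) coprod_linear.
HB.instance Definition _ (k : fieldType) (H : bialgType k) :=
  GRing.isMonoidMorphism.Build H (tensk H H) (@coprod k H)
    coprod_monoid_morphism.

(* The unital associative algebra presented by generators [UGen x], x in L,
   and the relations that [UGen] is linear and a Lie algebra morphism. *)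
Inductive uterm (k : fieldType) (L : lieAlgType k) :=
| UGen of L
| UScal of k
| UAdd of uterm L & uterm L
| UMul of uterm L & uterm L.

Arguments UScal {k L}.

HB.instance Definition _ (k : fieldType) (L : lieAlgType k) :=
  gen_eqMixin (uterm L).
HB.instance Definition _ (k : fieldType) (L : lieAlgType k) :=
  gen_choiceMixin (uterm L).

Section Uea.
Variables (k : fieldType) (L : lieAlgType k).

Inductive urel : uterm L -> uterm L -> Prop :=
| URefl s : urel s s
| USym s t : urel s t -> urel t s
| UTrans t s u : urel s t -> urel t u -> urel s u
| UAddCong s s' t t' : urel s s' -> urel t t' -> urel (UAdd s t) (UAdd s' t')
| UMulCong s s' t t' : urel s s' -> urel t t' -> urel (UMul s t) (UMul s' t')
| UAddA s t u : urel (UAdd s (UAdd t u)) (UAdd (UAdd s t) u)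
| UAddC s t : urel (UAdd s t) (UAdd t s)
| UAdd0 s : urel (UAdd (UScal 0) s) s
| UAddN s : urel (UAdd (UMul (UScal (- 1)) s) s) (UScal 0)
| UMulA s t u : urel (UMul s (UMul t u)) (UMul (UMul s t) u)
| UMul1l s : urel (UMul (UScal 1) s) s
| UMul1r s : urel (UMul s (UScal 1)) s
| UMulDl s t u : urel (UMul (UAdd s t) u) (UAdd (UMul s u) (UMul t u))
| UMulDr s t u : urel (UMul s (UAdd t u)) (UAdd (UMul s t) (UMul s u))
| UScalD a b : urel (UScal (a + b)) (UAdd (UScal a) (UScal b))
| UScalM a b : urel (UScal (a * b)) (UMul (UScal a) (UScal b))
| UScalC a s : urel (UMul (UScal a) s) (UMul s (UScal a))
| UGenD x y : urel (UGen (x + y)) (UAdd (UGen x) (UGen y))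
| UGenZ a x : urel (UGen (a *: x)) (UMul (UScal a) (UGen x))
| UGenLie x y : urel (UAdd (UGen (lie x y)) (UMul (UGen y) (UGen x)))
                     (UMul (UGen x) (UGen y)).

Definition urelb s t := `[< urel s t >].

Lemma urelb_refl : reflexive urelb.
Proof. by move=> s; apply/asboolP; apply: URefl. Qed.

Lemma urelb_sym : symmetric urelb.
Proof. by move=> s t; apply: asbool_equiv_eq; split; apply: USym. Qed.

Lemma urelb_trans : transitive urelb.
Proof.
by move=> t s u /asboolP st /asboolP tu; apply/asboolP; apply: UTrans st tu.
Qed.

Definition uequiv := EquivRel urelb urelb_refl urelb_sym urelb_trans.

Definition uea := {eq_quot uequiv}.
HB.instance Definition _ : EqQuotient _ uequiv uea := EqQuotient.on uea.
HB.instance Definition _ := Choice.on uea.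

Lemma uea_piP s t : reflect (urel s t) (\pi_uea s == \pi_uea t).
Proof. by rewrite eqmodE; apply: asboolP. Qed.

Lemma uea_pi_eq s t : urel s t -> \pi_uea s = \pi_uea t.
Proof. by move=> /uea_piP/eqP. Qed.

Lemma uea_reprK s : urel (repr (\pi_uea s)) s.
Proof. by apply/uea_piP; rewrite reprK. Qed.

Definition uscal (a : k) : uea := \pi_uea (UScal a).
Definition uadd (x y : uea) : uea := \pi_uea (UAdd (repr x) (repr y)).
Definition umul (x y : uea) : uea := \pi_uea (UMul (repr x) (repr y)).
Definition uopp (x : uea) : uea := umul (uscal (- 1)) x.

Lemma uea_surj (x : uea) : exists s, x = \pi_uea s.
Proof. by exists (repr x); rewrite reprK. Qed.

Lemma uadd_pi s t : uadd (\pi_uea s) (\pi_uea t) = \pi_uea (UAdd s t).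
Proof. by apply: uea_pi_eq; apply: UAddCong; apply: uea_reprK. Qed.

Lemma umul_pi s t : umul (\pi_uea s) (\pi_uea t) = \pi_uea (UMul s t).
Proof. by apply: uea_pi_eq; apply: UMulCong; apply: uea_reprK. Qed.

Let upi := (uadd_pi, umul_pi).

Lemma uaddA : associative uadd.
Proof.
move=> x y z.
case: (uea_surj x) (uea_surj y) (uea_surj z) => s -> [t ->] [u ->].
rewrite (uadd_pi t u) (uadd_pi s t) !uadd_pi; apply: uea_pi_eq.
exact: UAddA.
Qed.

Lemma uaddC : commutative uadd.
Proof. by move=> x y; apply: uea_pi_eq; apply: UAddC. Qed.

Lemma uadd0 : left_id (uscal 0) uadd.
Proof.
move=> x; case: (uea_surj x) => s ->; rewrite upi.
apply: uea_pi_eq; exact: UAdd0.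
Qed.

Lemma uaddN : left_inverse (uscal 0) uopp uadd.
Proof.
move=> x; case: (uea_surj x) => s ->; rewrite /uopp umul_pi uadd_pi.
apply: uea_pi_eq; exact: UAddN.
Qed.

HB.instance Definition _ := GRing.isZmodule.Build uea uaddA uaddC uadd0 uaddN.

Lemma umulA : associative umul.
Proof.
move=> x y z.
case: (uea_surj x) (uea_surj y) (uea_surj z) => s -> [t ->] [u ->].
rewrite (umul_pi t u) (umul_pi s t) !umul_pi; apply: uea_pi_eq.
exact: UMulA.
Qed.

Lemma umul1l : left_id (uscal 1) umul.
Proof.
move=> x; case: (uea_surj x) => s ->; rewrite upi.
apply: uea_pi_eq; exact: UMul1l.
Qed.

Lemma umul1r : right_id (uscal 1) umul.
Proof.
move=> x; case: (uea_surj x) => s ->; rewrite upi.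
apply: uea_pi_eq; exact: UMul1r.
Qed.

Lemma umulDl : left_distributive umul uadd.
Proof.
move=> x y z.
case: (uea_surj x) (uea_surj y) (uea_surj z) => s -> [t ->] [u ->].
rewrite (uadd_pi s t) (umul_pi s u) (umul_pi t u) umul_pi uadd_pi; apply: uea_pi_eq.
exact: UMulDl.
Qed.

Lemma umulDr : right_distributive umul uadd.
Proof.
move=> x y z.
case: (uea_surj x) (uea_surj y) (uea_surj z) => s -> [t ->] [u ->].
rewrite (uadd_pi t u) (umul_pi s t) (umul_pi s u) umul_pi uadd_pi; apply: uea_pi_eq.
exact: UMulDr.
Qed.

HB.instance Definition _ := GRing.Zmodule_isPzRing.Build uea
  umulA umul1l umul1r umulDl umulDr.

Section Eval.
Variables (A : algType k) (f : L -> A).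

Fixpoint ueval (t : uterm L) : A :=
  match t with
  | UGen x => f x
  | UScal a => a%:A
  | UAdd s t => ueval s + ueval t
  | UMul s t => ueval s * ueval t
  end.

Hypotheses (f_lin : linear f)
  (f_lie : forall x y, f (lie x y) = f x * f y - f y * f x).

Lemma ueval_rel s t : urel s t -> ueval s = ueval t.
Proof.
have fD x y : f (x + y) = f x + f y.
  by have := f_lin 1 x y; rewrite !scale1r.
have f0 : f 0 = 0 by apply: (addrI (f 0)); rewrite -fD !addr0.
have fZ a x : f (a *: x) = a *: f x.
  by have := f_lin a x 0; rewrite f0 !addr0.
elim=> {s t} //=.
- by move=> s t u _ -> _ ->.
- by move=> s s' t t' _ -> _ ->.
- by move=> s s' t t' _ -> _ ->.
- by move=> *; rewrite addrA.
- by move=> *; rewrite addrC.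
- by move=> *; rewrite scale0r add0r.
- by move=> *; rewrite scaleN1r mulN1r addNr scale0r.
- by move=> *; rewrite mulrA.
- by move=> *; rewrite scale1r mul1r.
- by move=> *; rewrite scale1r mulr1.
- by move=> *; rewrite mulrDl.
- by move=> *; rewrite mulrDr.
- by move=> *; rewrite scalerDl.
- by move=> *; rewrite -scalerAl mul1r scalerA.
- by move=> *; rewrite -scalerAl -scalerAr mulr1 mul1r.
- by move=> *; rewrite -scalerAl mul1r.
- by move=> *; rewrite f_lie subrK.
Qed.

End Eval.

Lemma uea_1_neq0 : (1 : uea) != 0.
Proof.
apply/eqP => /eqP/uea_piP/(@ueval_rel k^o (fun=> 0)) e.
have : (1 : k)%:A = (0 : k)%:A :> k^o.
  by apply: e => [a x y|x y]; rewrite ?scaler0 ?mulr0 ?subrr ?addr0.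
by move/eqP; rewrite scale1r scale0r oner_eq0.
Qed.

HB.instance Definition _ := GRing.PzSemiRing_isNonZero.Build uea uea_1_neq0.

Lemma uscalD : {morph uscal : a b / a + b}.
Proof.
move=> a b; have <- : uadd (uscal a) (uscal b) = uscal a + uscal b by [].
by rewrite /uscal uadd_pi; apply: uea_pi_eq; apply: UScalD.
Qed.

Lemma uscalM : {morph uscal : a b / a * b}.
Proof.
move=> a b; have <- : umul (uscal a) (uscal b) = uscal a * uscal b by [].
by rewrite /uscal umul_pi; apply: uea_pi_eq; apply: UScalM.
Qed.

Lemma uscalC a (x : uea) : uscal a * x = x * uscal a.
Proof.
rewrite -[x]reprK; change (umul (uscal a) (\pi_uea (repr x)) =
  umul (\pi_uea (repr x)) (uscal a)).
by rewrite /uscal !umul_pi; apply: uea_pi_eq; apply: UScalC.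
Qed.

Definition uscale (a : k) (x : uea) : uea := uscal a * x.

Lemma uscaleA a b x : uscale a (uscale b x) = uscale (a * b) x.
Proof. by rewrite /uscale uscalM mulrA. Qed.

Lemma uscale1 : left_id 1 uscale.
Proof. exact: umul1l. Qed.

Lemma uscaleDr : right_distributive uscale +%R.
Proof. by move=> a x y; apply: mulrDr. Qed.

Lemma uscaleDl x : {morph uscale^~ x : a b / a + b}.
Proof. by move=> a b; rewrite /uscale uscalD mulrDl. Qed.

HB.instance Definition _ := GRing.Zmodule_isLmodule.Build k uea
  uscaleA uscale1 uscaleDr uscaleDl.

Lemma uscaleAl (a : k) (x y : uea) : a *: (x * y) = (a *: x) * y.
Proof. exact: mulrA. Qed.

HB.instance Definition _ := GRing.Lmodule_isLalgebra.Build k uea uscaleAl.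

Lemma uscaleAr (a : k) (x y : uea) : a *: (x * y) = x * (a *: y).
Proof.
change (uscal a * (x * y) = x * (uscal a * y)).
by rewrite mulrA uscalC mulrA.
Qed.

HB.instance Definition _ := GRing.Lalgebra_isAlgebra.Build k uea uscaleAr.

Definition ugen (x : L) : uea := \pi_uea (UGen x).

Lemma uscalE a : uscal a = a%:A.
Proof. by change (uscal a = uscal a * 1); rewrite mulr1. Qed.

Lemma ugen_linear : linear ugen.
Proof.
move=> a x y; change (ugen (a *: x + y) =
  uadd (umul (uscal a) (ugen x)) (ugen y)).
rewrite /ugen /uscal !upi; apply: uea_pi_eq.
apply: UTrans (UGenD _ _) _; apply: UAddCong; last exact: URefl.
exact: UGenZ.
Qed.

HB.instance Definition _ := GRing.isLinear.Build k L uea _ ugen ugen_linear.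

Lemma ugen_lie x y : ugen (lie x y) = ugen x * ugen y - ugen y * ugen x.
Proof.
apply/(canRL (addrK _)).
change (uadd (ugen (lie x y)) (umul (ugen y) (ugen x)) =
  umul (ugen x) (ugen y)).
by rewrite /ugen !upi; apply: uea_pi_eq; apply: UGenLie.
Qed.

Lemma uea_ind (Q : uea -> Prop) :
  (forall x, Q (ugen x)) -> (forall a, Q a%:A) ->
  (forall x y, Q x -> Q y -> Q (x + y)) ->
  (forall x y, Q x -> Q y -> Q (x * y)) -> forall x, Q x.
Proof.
move=> Qg Qs QD QM x; rewrite -[x]reprK.
elim: (repr x) => [y|a|s IHs t IHt|s IHs t IHt].
- exact: Qg.
- by have := Qs a; rewrite -uscalE.
- by have := QD _ _ IHs IHt; rewrite -uadd_pi.
- by have := QM _ _ IHs IHt; rewrite -umul_pi.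
Qed.

(* The algebra morphism extending f when f is a Lie algebra morphism, see
   [uea_universal]; of no significance for other f. *)
Definition ulift (A : algType k) (f : L -> A) (x : uea) : A :=
  ueval f (repr x).

Section Lift.
Variables (A : algType k) (f : L -> A).
Hypotheses (f_lin : linear f)
  (f_lie : forall x y, f (lie x y) = f x * f y - f y * f x).

Lemma ulift_pi t : ulift f (\pi_uea t) = ueval f t.
Proof. exact/ueval_rel/uea_reprK. Qed.

Lemma ulift_gen x : ulift f (ugen x) = f x.
Proof. exact: ulift_pi. Qed.

Lemma ulift_scal a : ulift f a%:A = a%:A.
Proof. by rewrite -uscalE ulift_pi. Qed.

Lemma uliftD : {morph ulift f : x y / x + y}.
Proof.
move=> x y; case: (uea_surj x) (uea_surj y) => s -> [t ->].
change (ulift f (uadd (\pi_uea s) (\pi_uea t)) =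
  ulift f (\pi_uea s) + ulift f (\pi_uea t)).
by rewrite uadd_pi !ulift_pi.
Qed.

Lemma uliftM : {morph ulift f : x y / x * y}.
Proof.
move=> x y; case: (uea_surj x) (uea_surj y) => s -> [t ->].
change (ulift f (umul (\pi_uea s) (\pi_uea t)) =
  ulift f (\pi_uea s) * ulift f (\pi_uea t)).
by rewrite umul_pi !ulift_pi.
Qed.

Lemma uliftZ a x : ulift f (a *: x) = a *: ulift f x.
Proof. by rewrite -mulr_algl uliftM ulift_scal mulr_algl. Qed.

End Lift.

Lemma uea_hom_ext (A : algType k) (g h : {lrmorphism uea -> A}) :
  (forall x, g (ugen x) = h (ugen x)) -> g =1 h.
Proof.
move=> gh; elim/uea_ind => [//|a|x y|x y] *.
- by rewrite !linearZ !rmorph1.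
- by rewrite !rmorphD; congr (_ + _).
- by rewrite !rmorphM; congr (_ * _).
Qed.

Theorem uea_universal (A : algType k) (f : L -> A) :
  linear f -> (forall x y, f (lie x y) = f x * f y - f y * f x) ->
  exists g : {lrmorphism uea -> A}, (forall x, g (ugen x) = f x) /\
    forall h : {lrmorphism uea -> A}, (forall x, h (ugen x) = f x) -> h =1 g.
Proof.
move=> f_lin f_lie.
have g_lin : linear (ulift f).
  by move=> a x y; rewrite uliftD // uliftZ.
have g_mul : monoid_morphism (ulift f).
  by split; [rewrite -[1]scale1r ulift_scal // scale1r | apply: uliftM].
pose gL := GRing.isLinear.Build _ _ _ _ _ g_lin.
pose gM := GRing.isMonoidMorphism.Build _ _ _ g_mul.
pose g : {lrmorphism uea -> A} := HB.pack (ulift f) gL gM.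
exists g; split=> [x|h hf]; first exact: ulift_gen.
by apply: uea_hom_ext => x; rewrite hf; symmetry; exact: ulift_gen.
Qed.

Definition counit : uea -> k := ulift (fun=> 0 : k^o).

Let zero_lin : linear (fun _ : L => 0 : k^o).
Proof. by move=> a x y /=; rewrite scaler0 addr0. Qed.
Let zero_lie (x y : L) : (0 : k^o) = 0 * 0 - 0 * 0.
Proof. by rewrite mulr0 subrr. Qed.

Lemma counitD : {morph counit : x y / x + y}.
Proof. exact: (uliftD zero_lin zero_lie). Qed.
Lemma counitZ c x : counit (c *: x) = c * counit x.
Proof. exact: (uliftZ zero_lin zero_lie). Qed.
Lemma counit1 : counit 1 = 1.
Proof. by rewrite -[1]scale1r /counit ulift_scal // scale1r. Qed.
Lemma counit_gen x : counit (ugen x) = 0.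
Proof. exact: (ulift_gen zero_lin zero_lie). Qed.
Lemma counitM : {morph counit : x y / x * y}.
Proof. exact: (uliftM zero_lin zero_lie). Qed.

HB.instance Definition _ := Algebra_hasAugmentation.Build k uea
  counitD counitZ counit1 counitM.

Local Notation HH := (tensk uea uea).

Definition primitive (x : L) : HH := purek (ugen x) 1 + purek 1 (ugen x).

Definition ucoprod : uea -> HH := ulift primitive.

Lemma primitive_linear : linear primitive.
Proof.
move=> a x y; rewrite /primitive linearP purekDl purekDr scalerDr !scale_purek.
by rewrite -purekZ addrACA.
Qed.

Lemma primitive_lie x y :
  primitive (lie x y) =
  primitive x * primitive y - primitive y * primitive x.
Proof.
have pNl (a b : uea) : purek (- a) b = - purek a b.
  apply: (addrI (purek a b)); rewrite -purekDl !subrr.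
  by rewrite -[0 in LHS](scale0r 0) -scale_purek scale0r.
have pNr (a b : uea) : purek a (- b) = - purek a b.
  by rewrite -scaleN1r -purekZ -scale_purek scaleN1r.
rewrite /primitive ugen_lie !mulrDl !mulrDr !purekM !mul1r !mulr1.
rewrite purekDl purekDr pNl pNr !opprD.
rewrite [X in _ = X + _]addrACA [RHS]addrACA [X in _ = X + _]addrACA.
by rewrite [X in _ = _ + X]addrACA !subrr addr0 add0r.
Qed.

Lemma ucoprod_gen x :
  ucoprod (ugen x) = purek (ugen x) 1 + purek 1 (ugen x).
Proof. exact: (ulift_gen primitive_linear primitive_lie). Qed.

Lemma ucoprod_linear : linear ucoprod.
Proof.
by move=> a x y; rewrite /ucoprod (uliftD primitive_linear primitive_lie)
  (uliftZ primitive_linear primitive_lie).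
Qed.

Lemma ucoprod_monoid_morphism : monoid_morphism ucoprod.
Proof.
split; last exact: (uliftM primitive_linear primitive_lie).
rewrite -[1 in LHS]scale1r /ucoprod.
by rewrite (ulift_scal primitive_linear primitive_lie) scale1r.
Qed.

End Uea.

Section Coassociativity.
Variables (k : fieldType) (H : augAlgType k) (D : {lrmorphism H -> tensk H H}).

Definition coassoc_at h :=
  tmap D idfun (D h) = tassoc (tmap idfun D (D h)).

Lemma counitl_balanced : balanced (fun (a : H) (c : k) => c *: a)
  (fun a (b : H) => augm a *: b).
Proof.
apply: balancedk => *; rewrite ?augmD ?scalerDl ?scalerDr //.
by rewrite augmZ scalerA mulrC.
Qed.

Lemma counitr_balanced : balanced (fun (a : H) (c : k) => c *: a)
  (fun (a b : H) => augm b *: a).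
Proof.
apply: balancedk => *; rewrite ?augmD ?scalerDl ?scalerDr //.
by rewrite augmZ scalerA mulrC.
Qed.

Definition counitl : tensk H H -> H := tliftk (fun a b => augm a *: b).
Definition counitr : tensk H H -> H := tliftk (fun a b => augm b *: a).

Lemma counitl_pure a b : counitl (purek a b) = augm a *: b.
Proof. by apply: tliftk_pure; apply: counitl_balanced. Qed.

Lemma counitr_pure a b : counitr (purek a b) = augm b *: a.
Proof. by apply: tliftk_pure; apply: counitr_balanced. Qed.

Lemma counitlD : {morph counitl : x y / x + y}.
Proof. by apply: tliftkD; apply: counitl_balanced. Qed.

Lemma counitrD : {morph counitr : x y / x + y}.
Proof. by apply: tliftkD; apply: counitr_balanced. Qed.

Lemma counitlM : {morph counitl : x y / x * y}.
Proof.
move=> x y; move: x; apply: tensk_ext => [x x'|x x'|a b];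
  rewrite ?mulrDl ?counitlD ?mulrDl //.
move: y; apply: tensk_ext => [x x'|x x'|a' b'];
  rewrite ?mulrDr ?counitlD ?mulrDr //.
by rewrite purekM !counitl_pure augmM -scalerAl -scalerAr scalerA.
Qed.

Lemma counitrM : {morph counitr : x y / x * y}.
Proof.
move=> x y; move: x; apply: tensk_ext => [x x'|x x'|a b];
  rewrite ?mulrDl ?counitrD ?mulrDl //.
move: y; apply: tensk_ext => [x x'|x x'|a' b'];
  rewrite ?mulrDr ?counitrD ?mulrDr //.
by rewrite purekM !counitr_pure augmM -scalerAl -scalerAr scalerA.
Qed.

Definition counit_at h := counitl (D h) = h /\ counitr (D h) = h.

Lemma counit_atM h g : counit_at h -> counit_at g -> counit_at (h * g).
Proof. by rewrite /counit_at rmorphM counitlM counitrM => -[-> ->] [-> ->]. Qed.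

Lemma counit_atD h g : counit_at h -> counit_at g -> counit_at (h + g).
Proof. by rewrite /counit_at rmorphD counitlD counitrD => -[-> ->] [-> ->]. Qed.

Lemma counit_at_scal a : counit_at a%:A.
Proof.
have DE : D a%:A = purek a%:A 1 by rewrite linearZ rmorph1 -scale_purek.
by rewrite /counit_at DE counitl_pure counitr_pure augmZ augm1 mulr1 scale1r.
Qed.

Lemma counit_at_primitive h : augm h = 0 ->
  D h = purek h 1 + purek 1 h -> counit_at h.
Proof.
move=> h0 Dh; rewrite /counit_at Dh counitlD counitrD.
rewrite !counitl_pure !counitr_pure h0 !augm1 !scale0r !scale1r.
by rewrite add0r addr0.
Qed.

Lemma coassoc_atM h g : coassoc_at h -> coassoc_at g -> coassoc_at (h * g).
Proof.
rewrite /coassoc_at => hh gg; rewrite (rmorphM D).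
apply: (etrans (tmapM D idfun (D h) (D g))).
apply: (etrans (congr2 *%R hh gg)).
apply: (etrans (esym (tassocM _ _))); congr (tassoc _).
exact: (esym (tmapM idfun D (D h) (D g))).
Qed.

Lemma coassoc_atD h g : coassoc_at h -> coassoc_at g -> coassoc_at (h + g).
Proof.
rewrite /coassoc_at => hh gg; rewrite (raddfD D).
apply: (etrans (tmapD D idfun (D h) (D g))).
apply: (etrans (congr2 +%R hh gg)).
apply: (etrans (esym (tassocD _ _))); congr (tassoc _).
exact: (esym (tmapD idfun D (D h) (D g))).
Qed.

Lemma coassoc_at_scal a : coassoc_at a%:A.
Proof.
have DE : D a%:A = purek a%:A 1 by rewrite linearZ rmorph1 -scale_purek.
by rewrite /coassoc_at DE !tmap_pure /= DE rmorph1 tassoc_pure.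
Qed.

Lemma coassoc_at_primitive h :
  D h = purek h 1 + purek 1 h -> coassoc_at h.
Proof.
move=> Dh; rewrite /coassoc_at Dh !tmapD !tmap_pure /= Dh !rmorph1.
by rewrite tassocD purekDl purekDr tassocD !tassoc_pure addrA.
Qed.

End Coassociativity.

Section UeaBialgebra.
Variables (k : fieldType) (L : lieAlgType k).

HB.instance Definition _ := GRing.isLinear.Build k (uea L)
  (tensk (uea L) (uea L)) _ (@ucoprod k L) (@ucoprod_linear k L).
HB.instance Definition _ := GRing.isMonoidMorphism.Build (uea L)
  (tensk (uea L) (uea L)) (@ucoprod k L) (@ucoprod_monoid_morphism k L).

Let D : {lrmorphism uea L -> tensk (uea L) (uea L)} := @ucoprod k L.

Lemma ucoprod_coassoc h : coassoc_at D h.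
Proof.
elim/uea_ind: h => [x|a|x y|x y].
- by apply: coassoc_at_primitive; apply: ucoprod_gen.
- exact: coassoc_at_scal.
- exact: coassoc_atD.
- exact: coassoc_atM.
Qed.

Lemma ucoprod_counit h : counit_at D h.
Proof.
elim/uea_ind: h => [x|a|x y|x y].
- apply: counit_at_primitive; last exact: ucoprod_gen.
  exact: counit_gen.
- exact: counit_at_scal.
- exact: counit_atD.
- exact: counit_atM.
Qed.

HB.instance Definition _ := AugAlgebra_isBialgebra.Build k (uea L)
  (@ucoprod_linear k L) (@ucoprod_monoid_morphism k L) ucoprod_coassoc
  (fun h => proj1 (ucoprod_counit h)) (fun h => proj2 (ucoprod_counit h)).

End UeaBialgebra.

Section Pseudo.
Variables (k : fieldType) (H : bialgType k).
Local Notation HH := (tensk H H).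
Local Notation HHH := (tensk (tensk H H) H).

(* Delta (x) id and id (x) Delta. *)
Definition coprod_l : HH -> HHH := tmap coprod idfun.
Definition coprod_r (x : HH) : HHH := tassoc (tmap idfun coprod x).

Lemma coprod_l_pure a b : coprod_l (purek a b) = purek (coprod a) b.
Proof. exact: tmap_pure. Qed.

Lemma coprod_lD : {morph coprod_l : x y / x + y}.
Proof. exact: tmapD. Qed.

Lemma coprod_lM : {morph coprod_l : x y / x * y}.
Proof. exact: tmapM. Qed.

Lemma coprod_r_pure a b : coprod_r (purek a b) = tassoc (purek a (coprod b)).
Proof. by rewrite /coprod_r tmap_pure. Qed.

Lemma coprod_rD : {morph coprod_r : x y / x + y}.
Proof.
move=> x y; apply: (etrans _ (tassocD _ _)); congr (tassoc _).
exact: (tmapD idfun coprod x y).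
Qed.

Lemma coprod_rM : {morph coprod_r : x y / x * y}.
Proof.
move=> x y; apply: (etrans _ (tassocM _ _)); congr (tassoc _).
exact: (tmapM idfun coprod x y).
Qed.

Lemma coprod_lr h : coprod_l (coprod h) = coprod_r (coprod h).
Proof. exact: coprod_coassoc. Qed.

Definition act2 (x : HH) (h : H) : HH := x * coprod h.
Definition act3 (x : HHH) (h : H) : HHH := x * coprod_l (coprod h).

Variable A : lmodType H.

(* H^(x)2 (x)_H A and H^(x)3 (x)_H A. *)
Definition tens2 := tens act2 A.
Definition tens3 := tens act3 A.

HB.instance Definition _ := GRing.Zmodule.on tens2.
HB.instance Definition _ := GRing.Zmodule.on tens3.

Definition pure2 (x : HH) (c : A) : tens2 := pure act2 x c.
Definition pure3 (x : HHH) (c : A) : tens3 := pure act3 x c.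

(* b (a (x)_H c) = b a (x)_H c. *)
Definition lmul2 (b : HH) (t : tens2) : tens2 :=
  tlift (fun a c => pure2 (b * a) c) t.
Definition lmul3 (b : HHH) (t : tens3) : tens3 :=
  tlift (fun a c => pure3 (b * a) c) t.

(* (Delta (x) id) (x)_H id and (id (x) Delta) (x)_H id. *)
Definition coprod_lA (t : tens2) : tens3 :=
  tlift (fun a c => pure3 (coprod_l a) c) t.
Definition coprod_rA (t : tens2) : tens3 :=
  tlift (fun a c => pure3 (coprod_r a) c) t.

Lemma lmul2_balanced b : balanced act2 (fun a (c : A) => pure2 (b * a) c).
Proof.
split=> *; rewrite ?mulrDr /pure2 ?pureDl ?pureDr //.
by rewrite -pure_bal /act2 mulrA.
Qed.

Lemma lmul3_balanced b : balanced act3 (fun a (c : A) => pure3 (b * a) c).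
Proof.
split=> *; rewrite ?mulrDr /pure3 ?pureDl ?pureDr //.
by rewrite -pure_bal /act3 mulrA.
Qed.

Lemma coprod_lA_balanced :
  balanced act2 (fun a (c : A) => pure3 (coprod_l a) c).
Proof.
split=> *; rewrite ?coprod_lD /pure3 ?pureDl ?pureDr //.
by rewrite -pure_bal /act3 -coprod_lM.
Qed.

Lemma coprod_rA_balanced :
  balanced act2 (fun a (c : A) => pure3 (coprod_r a) c).
Proof.
split=> *; rewrite ?coprod_rD /pure3 ?pureDl ?pureDr //.
by rewrite -pure_bal /act3 coprod_lr -coprod_rM.
Qed.

Lemma lmul2_pure b a c : lmul2 b (pure2 a c) = pure2 (b * a) c.
Proof. exact: (tlift_pure (lmul2_balanced b)). Qed.

Lemma lmul2D b : {morph lmul2 b : x y / x + y}.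
Proof. exact: (tliftD (lmul2_balanced b)). Qed.

Lemma lmul3_pure b a c : lmul3 b (pure3 a c) = pure3 (b * a) c.
Proof. exact: (tlift_pure (lmul3_balanced b)). Qed.

Lemma lmul3D b : {morph lmul3 b : x y / x + y}.
Proof. exact: (tliftD (lmul3_balanced b)). Qed.

Lemma coprod_lA_pure a c : coprod_lA (pure2 a c) = pure3 (coprod_l a) c.
Proof. exact: (tlift_pure coprod_lA_balanced). Qed.

Lemma coprod_lAD : {morph coprod_lA : x y / x + y}.
Proof. exact: (tliftD coprod_lA_balanced). Qed.

Lemma coprod_rA_pure a c : coprod_rA (pure2 a c) = pure3 (coprod_r a) c.
Proof. exact: (tlift_pure coprod_rA_balanced). Qed.

Lemma coprod_rAD : {morph coprod_rA : x y / x + y}.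
Proof. exact: (tliftD coprod_rA_balanced). Qed.

(* Biadditivity and H-bilinearity; k-bilinearity is the case of scalars. *)
Record pseudoproduct (pp : A -> A -> tens2) : Prop := Pseudoproduct {
  ppDl : forall x x' y, pp (x + x') y = pp x y + pp x' y;
  ppDr : forall x y y', pp x (y + y') = pp x y + pp x y';
  ppH : forall (h g : H) x y, pp (h *: x) (g *: y) = lmul2 (purek h g) (pp x y)
}.

(* (b (x)_H x) * y and x * (b (x)_H y), see [ppl_pure] and [ppr_pure]. *)
Definition ppl (pp : A -> A -> tens2) (t : tens2) (y : A) : tens3 :=
  tlift (fun (b : HH) x => lmul3 (purek b 1) (coprod_lA (pp x y))) t.
Definition ppr (pp : A -> A -> tens2) (x : A) (t : tens2) : tens3 :=
  tlift (fun (b : HH) y => lmul3 (tassoc (purek 1 b)) (coprod_rA (pp x y))) t.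

Definition pseudo_associative (pp : A -> A -> tens2) : Prop :=
  forall x y z, ppl pp (pp x y) z = ppr pp x (pp y z).

Section PseudoTheory.
Variables (pp : A -> A -> tens2) (ppP : pseudoproduct pp).

Lemma lmul3_Dl b b' t : lmul3 (b + b') t = lmul3 b t + lmul3 b' t.
Proof.
move: t; apply: tens_ext => [||a c]; first exact: lmul3D.
  exact: add_fun_morph (@lmul3D b) (@lmul3D b').
change (lmul3 (b + b') (pure3 a c) = lmul3 b (pure3 a c) + lmul3 b' (pure3 a c)).
by rewrite !lmul3_pure mulrDl /pure3 pureDl.
Qed.

Lemma lmul3A b b' t : lmul3 b (lmul3 b' t) = lmul3 (b * b') t.
Proof.
move: t; apply: tens_ext => [||a c]; last 1 first.
- change (lmul3 b (lmul3 b' (pure3 a c)) = lmul3 (b * b') (pure3 a c)).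
  by rewrite !lmul3_pure mulrA.
- exact: add_comp_morph (@lmul3D b) (@lmul3D b').
- exact: lmul3D.
Qed.

Lemma coprod_lA_lmul b t :
  coprod_lA (lmul2 b t) = lmul3 (coprod_l b) (coprod_lA t).
Proof.
move: t; apply: tens_ext => [||a c]; last 1 first.
- change (coprod_lA (lmul2 b (pure2 a c)) =
    lmul3 (coprod_l b) (coprod_lA (pure2 a c))).
  by rewrite lmul2_pure !coprod_lA_pure lmul3_pure coprod_lM.
- exact: add_comp_morph coprod_lAD (@lmul2D b).
- exact: add_comp_morph (@lmul3D _) coprod_lAD.
Qed.

Lemma coprod_rA_lmul b t :
  coprod_rA (lmul2 b t) = lmul3 (coprod_r b) (coprod_rA t).
Proof.
move: t; apply: tens_ext => [||a c]; last 1 first.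
- change (coprod_rA (lmul2 b (pure2 a c)) =
    lmul3 (coprod_r b) (coprod_rA (pure2 a c))).
  by rewrite lmul2_pure !coprod_rA_pure lmul3_pure coprod_rM.
- exact: add_comp_morph coprod_rAD (@lmul2D b).
- exact: add_comp_morph (@lmul3D _) coprod_rAD.
Qed.

Lemma ppl_balanced y : balanced act2
  (fun (b : HH) x => lmul3 (purek b 1) (coprod_lA (pp x y))).
Proof.
case: ppP => Dl _ Hl; split=> [b b' x|b x x'|b h x].
- by rewrite purekDl lmul3_Dl.
- by rewrite Dl coprod_lAD lmul3D.
rewrite -[in RHS](scale1r y) Hl coprod_lA_lmul lmul3A coprod_l_pure.
by rewrite purekM mul1r.
Qed.

Lemma ppr_balanced x : balanced act2
  (fun (b : HH) y => lmul3 (tassoc (purek 1 b)) (coprod_rA (pp x y))).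
Proof.
case: ppP => _ Dr Hr; split=> [b b' y|b y y'|b h y].
- by rewrite purekDr tassocD lmul3_Dl.
- by rewrite Dr coprod_rAD lmul3D.
rewrite -[in RHS](scale1r x) Hr coprod_rA_lmul lmul3A coprod_r_pure.
congr (lmul3 _ _); apply: (etrans _ (tassocM _ _)); congr (tassoc _).
by apply: (etrans _ (esym (@purekM k H HH _ _ _ _))); rewrite mul1r.
Qed.

Lemma ppl_pure b x y :
  ppl pp (pure2 b x) y = lmul3 (purek b 1) (coprod_lA (pp x y)).
Proof. exact: (tlift_pure (ppl_balanced y)). Qed.

Lemma pplD y : {morph ppl pp ^~ y : t u / t + u}.
Proof. exact: (tliftD (ppl_balanced y)). Qed.

Lemma ppr_pure b x y :
  ppr pp x (pure2 b y) = lmul3 (tassoc (purek 1 b)) (coprod_rA (pp x y)).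
Proof. exact: (tlift_pure (ppr_balanced x)). Qed.

Lemma pprD x : {morph ppr pp x : t u / t + u}.
Proof. exact: (tliftD (ppr_balanced x)). Qed.

End PseudoTheory.

Definition is_basis2 (e1 e2 : A) : Prop :=
  forall x, exists! h : H * H, x = h.1 *: e1 + h.2 *: e2.

End Pseudo.

(* Main.v *)
Require Import Defs.
From HB Require Import structures.
From mathcomp Require Import all_boot all_order all_algebra.
From mathcomp Require Import boolp classical_sets zify.

(** Write H for the enveloping algebra and e1 * e2 = a (x)_H e1 + b (x)_H e2
    with a, b in H (x) H. Since e2 * e2 = 0, the e1-coordinate of
    (e1 * e2) * e2 = e1 * (e2 * e2) = 0 reads
    (a (x) 1) (Delta (x) id)(a) = 0; since e1 * e1 = 0, the e2-coordinate
    of e1 * (e1 * e2) = 0 reads (1 (x) b) (id (x) Delta)(b) = 0. The theorem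
    follows if these two equations only have the zero solution, exchanging e1
    and e2 to treat e2 * e1.

    Slicing (a (x) 1) (Delta (x) id)(a) = 0 by a functional psi on the last
    factor gives a Delta(a') = 0 with a' = (id (x) psi)(a), and a is zero
    as soon as all its slices a' are. So the point is that t Delta(x) = 0 in
    H (x) H forces t = 0 or x = 0 ([mul_coprod_eq0]), which holds in every
    conilpotent bialgebra over a field of characteristic 0.

    The degree comes from the coproduct. A functional phi with phi(1) = 0
    acts on H by L = (phi (x) id) Delta ([contract]), and x has degree
    < n+1 when every such L sends it to degree < n, only 0 having degree
    < 0 ([deglt]). Generators have degree at most 1, so every element of an
    enveloping algebra has finite degree. Each L is a derivation up to terms
    of lower degree ([deglt_contractM]), hence leading parts multiply as in a
    polynomial ring and do not cancel ([degltM_sharp]): apply L to x and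
    y as often as their leading parts allow, i and j times; by Leibniz'
    rule L^(i+j)(x y) is, up to lower terms, L^i(x) L^j(y) times the
    binomial coefficient of i+j over i, which is non-zero in characteristic
    0, and the degrees have dropped. In degree 0 the elements are scalars.

    Finally Delta(x) - 1 (x) x lies in H (x) (lower degree), so slicing
    t Delta(x) = 0 by a functional phi for which (phi (x) id)(t) has
    maximal degree shows that (phi (x) id)(t) x has lower degree than the
    product of the leading parts. *)

Set Implicit Arguments.
Unset Strict Implicit.
Unset Printing Implicit Defensive.

Import GRing.Theory.
Local Open Scope ring_scope.

(** * Linear functionals *)

Section Functionals.
Variables (k : fieldType) (V : lmodType k).

Definition subspace (W : V -> Prop) : Prop :=
  W 0 /\ forall c x y, W x -> W y -> W (c *: x + y).

Section SubspaceTheory.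
Variables (W : V -> Prop) (Wsub : subspace W).

Lemma subspaceD x y : W x -> W y -> W (x + y).
Proof. by case: Wsub => _ WP Wx Wy; rewrite -[x]scale1r; apply: WP. Qed.

Lemma subspaceZ c x : W x -> W (c *: x).
Proof. by case: Wsub => W0 WP Wx; rewrite -[_ *: _]addr0; apply: WP. Qed.

Lemma subspaceB x y : W x -> W y -> W (x - y).
Proof. by move=> Wx Wy; rewrite -scaleN1r; apply/subspaceD/subspaceZ. Qed.

Lemma subspace_sum (I : eqType) (r : seq I) (F : I -> V) :
  {in r, forall i, W (F i)} -> W (\sum_(i <- r) F i).
Proof.
move=> WF; rewrite big_seq; apply: big_ind => //; first by case: Wsub.
exact: subspaceD.
Qed.

End SubspaceTheory.

Lemma scalar_functional (f : V -> k) :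
  scalar f -> exists phi : {scalar V}, phi =1 f.
Proof.
move=> fP; pose fL := GRing.isLinear.Build _ _ _ _ _ fP.
by pose phi : {scalar V} := HB.pack f fL; exists phi.
Qed.

(** By Zorn's lemma there is a maximal subspace U containing W but not v. Then U
    has codimension 1, with complement the line of v, and the functional is the
    coordinate along v. *)
Lemma subspace_separation (W : V -> Prop) (v : V) : subspace W -> ~ W v ->
  exists phi : {scalar V}, (forall w, W w -> phi w = 0) /\ phi v = 1.
Proof.
move=> Wsub Wv.
(* The union with W makes the empty chain satisfy the condition. *)
pose P (X : set V) := subspace (X `|` W)%classic /\ ~ (X `|` W)%classic v.
have [F FP Ftot|A [[Usub Uv] Amax]] := @Zorn_bigcup V P.
  split; last by case=> [[X /FP[_ Xv] ?]|//]; apply: Xv; left.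
  split=> [|c x y]; first by right; case: Wsub.
  have Win X z : W z -> (X `|` W)%classic z by right.
  have up X z : F X -> (X `|` W)%classic z ->
      ((\bigcup_(Y in F) Y) `|` W)%classic z.
    by move=> FX [Xz|]; [left; exists X|right].
  have lin X : F X -> (X `|` W)%classic x -> (X `|` W)%classic y ->
      ((\bigcup_(Y in F) Y) `|` W)%classic (c *: x + y).
    by move=> FX Xx Xy; apply: (up X _ FX); case: (FP X FX) => -[_ +] _; apply.
  case=> [[X FX Xx]|Wx] [[Y FY Yy]|Wy].
  - have [XY|YX] := Ftot X Y FX FY.
      by apply: (lin Y) => //; left=> //; apply: XY.
    by apply: (lin X) => //; left=> //; apply: YX.
  - by apply: (lin X) => //; [left|right].
  - by apply: (lin Y) => //; [right|left].
  - by right; case: Wsub => _; apply.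
pose U := (A `|` W)%classic.
(* If v were outside U + k u, the subspace B = U + k u would contradict
   maximality. *)
have dec u : exists c, U (u - c *: v).
  apply: contrapT => nc.
  have nU : ~ U u by move=> Uu; apply: nc; exists 0; rewrite scale0r subr0.
  pose B : set V := fun x => exists d, U (x - d *: u).
  have UB x : U x -> B x by move=> Ux; exists 0; rewrite scale0r subr0.
  have BE : (B `|` W)%classic = B.
    by apply/seteqP; split=> x; [case=> // Wx; apply: UB; right|left].
  apply: (Amax B).
    split; first by move=> x Ax; apply: UB; left.
    move=> /(_ u) BA; apply: nU; left; apply: BA.
    by exists 1; rewrite scale1r subrr; case: Usub.
  split; rewrite BE; first split.
  - by apply: UB; case: Usub.
  - move=> c x y [d Ud] [d' Ud']; exists (c * d + d').
    have -> : c *: x + y - (c * d + d') *: u =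
        c *: (x - d *: u) + (y - d' *: u).
      by rewrite scalerBr scalerA scalerDl opprD addrACA.
    by case: Usub => _; apply.
  - case=> d Ud; apply: nc; exists d^-1.
    have [d0|d0] := eqVneq d 0.
      by case: Uv; move: Ud; rewrite d0 scale0r subr0.
    have -> : u - d^-1 *: v = (- d^-1) *: (v - d *: u).
      by rewrite scalerBr !scaleNr scalerA mulVf // scale1r opprK addrC.
    exact: subspaceZ.
have [f fP] := choice dec.
have uniq u c : U (u - c *: v) -> f u = c.
  move=> Uc; apply/eqP; rewrite -subr_eq0; apply/negPn/negP => nz; apply: Uv.
  rewrite -[v]scale1r -(mulVf nz) -scalerA; apply: (subspaceZ Usub).
  have -> : (f u - c) *: v = (u - c *: v) - (u - f u *: v).
    by rewrite scalerBl [in RHS]addrC opprB addrA subrK.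
  exact: (subspaceB Usub Uc (fP u)).
have flin : scalar f.
  move=> c x y; apply: uniq.
  have -> : c *: x + y - (c * f x + f y) *: v =
      c *: (x - f x *: v) + (y - f y *: v).
    by rewrite scalerBr scalerA scalerDl opprD addrACA.
  exact: (proj2 Usub _ _ _ (fP x) (fP y)).
have [phi phiE] := scalar_functional flin.
exists phi; split=> [w Ww|]; rewrite phiE; apply: uniq.
  by rewrite scale0r subr0; right.
by rewrite scale1r subrr; case: Usub.
Qed.

End Functionals.

(** * Slices of tensors *)

Section Slices.
Variables (k : fieldType) (A B : lmodType k).

Lemma purek0l (b : B) : purek (0 : A) b = 0.
Proof. by rewrite -[0 in LHS](scale0r 0) -scale_purek scale0r. Qed.

Lemma purek0r (a : A) : purek a (0 : B) = 0.
Proof. by rewrite -[0 in LHS](scale0r 0) -purekZ scale0r purek0l. Qed.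

Definition slice (phi : {scalar A}) : tensk A B -> B :=
  tliftk (fun a b => phi a *: b).

Lemma slice_balanced (phi : {scalar A}) :
  balanced (fun (a : A) (c : k) => c *: a) (fun a (b : B) => phi a *: b).
Proof.
apply: balancedk => *; rewrite ?raddfD ?scalerDl ?scalerDr //.
by rewrite linearZ scalerA mulrC.
Qed.

Lemma slice_pure phi a b : slice phi (purek a b) = phi a *: b.
Proof. by apply: tliftk_pure; apply: slice_balanced. Qed.

Lemma sliceD phi : {morph slice phi : t u / t + u}.
Proof. by apply: tliftkD; apply: slice_balanced. Qed.

Lemma slice_linear phi : linear (slice phi).
Proof.
move=> c t u; rewrite sliceD; congr (_ + _); move: t; apply: tensk_ext.
- by move=> t t'; rewrite scalerDr sliceD.
- by move=> t t'; rewrite sliceD scalerDr.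
- by move=> a b; rewrite scale_purek !slice_pure linearZ scalerA.
Qed.

HB.instance Definition _ phi :=
  GRing.isLinear.Build k (tensk A B) B _ (slice phi) (slice_linear phi).

Lemma sliceB phi : {morph slice phi : t u / t - u}.
Proof. exact: linearB. Qed.

Lemma sliceZ phi c t : slice phi (c *: t) = c *: slice phi t.
Proof. exact: linearZ. Qed.

Lemma slice_sum phi (I : Type) (r : seq I) (F : I -> tensk A B) :
  slice phi (\sum_(i <- r) F i) = \sum_(i <- r) slice phi (F i).
Proof. exact: linear_sum. Qed.

Lemma tensk_sum (t : tensk A B) :
  exists s : seq (A * B), t = \sum_(p <- s) purek p.1 p.2.
Proof. by exists (repr t); apply: tensE. Qed.

Lemma in_span (s : seq A) (a : A) :
  (exists c : nat -> k, a = \sum_(i < size s) c i *: s`_i) \/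
  exists phi : {scalar A}, {in s, forall w, phi w = 0} /\ phi a = 1.
Proof.
pose W (x : A) := exists c : nat -> k, x = \sum_(i < size s) c i *: s`_i.
have Wsub : subspace W.
  split=> [|c x y [f ->] [g ->]].
    by exists (fun=> 0); rewrite big1 // => i _; rewrite scale0r.
  exists (fun i => c * f i + g i); rewrite scaler_sumr -big_split /=.
  by apply: eq_bigr => i _; rewrite scalerDl scalerA.
have [|Wa] := EM (W a); [by left|right].
have [phi [phiW phia]] := subspace_separation Wsub Wa.
exists phi; split=> // w /(nthP 0)[i ltis <-]; apply: phiW.
exists (fun j => (j == i)%:R); rewrite (bigD1 (Ordinal ltis)) //= eqxx scale1r.
rewrite big1 ?addr0 // => j; rewrite -val_eqE /= => /negbTE ->.
by rewrite scale0r.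
Qed.

(** Induction on the number of terms: if the first left factor depends linearly
    on the others, distribute its term over them; otherwise some functional
    isolates it, which puts its right factor in W, and the other terms still
    have all their slices in W. *)
Lemma slices_in_subspace (W : B -> Prop) (t : tensk A B) : subspace W ->
  (forall phi, W (slice phi t)) ->
  exists2 s : seq (A * B), (forall p, p \in s -> W p.2) &
    t = \sum_(p <- s) purek p.1 p.2.
Proof.
move=> Wsub; have [s ->] := tensk_sum t.
move: {2}(size s) (leqnn (size s)) => n; elim: n s => [|n IHn] [|[a b] s] //=.
- by move=> _ _; exists [::] => //; rewrite !big_nil.
- by move=> _ _; exists [::] => //; rewrite !big_nil.
rewrite ltnS => les; rewrite big_cons /= => Wt.
have [[c ac]|[phi [phis phia]]] := in_span (unzip1 s) a.
  pose s' := [seq (p.1.1, p.1.2 + c p.2 *: b) | p <- zip s (iota 0 (size s))].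
  have szs' : size s' = size s by rewrite size_map size1_zip ?size_iota.
  suff E : purek a b + \sum_(p <- s) purek p.1 p.2 =
      \sum_(p <- s') purek p.1 p.2.
    by rewrite E; apply: IHn; rewrite ?szs' // => phi; rewrite -E.
  rewrite ac size_map (big_nth (0, 0)) big_mkord [RHS](big_nth (0, 0)) szs'.
  rewrite big_mkord.
  rewrite
    (big_morph (fun x => purek x b) (fun _ _ => purekDl _ _ _) (id1 := 0));
    last exact: purek0l.
  rewrite -big_split /=; apply: eq_bigr => i _.
  rewrite (nth_map ((0,0),0)) ?size1_zip ?size_iota //.
  rewrite nth_zip ?size_iota // nth_iota // add0n (nth_map (0, 0)) //=.
  by rewrite purekDr addrC purekZ.
have Wb : W b.
  have := Wt phi; rewrite sliceD slice_pure phia scale1r slice_sum big1_seq.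
    by rewrite addr0.
  by move=> p /= ps; rewrite slice_pure phis ?scale0r // map_f.
have [|r Wr ->] := IHn s les.
  move=> psi; have -> : slice psi (\sum_(p <- s) purek p.1 p.2) =
      slice psi (purek a b + \sum_(p <- s) purek p.1 p.2) - psi a *: b.
    by rewrite sliceD slice_pure addrC addKr.
  exact: subspaceB (subspaceZ _ _ _).
exists ((a, b) :: r); last by rewrite big_cons.
by move=> p; rewrite inE => /predU1P[->|/Wr].
Qed.

Lemma slices_eq0 (t : tensk A B) : (forall phi, slice phi t = 0) -> t = 0.
Proof.
move=> t0; have [|//|s s0 ->] := @slices_in_subspace (fun b => b = 0) t.
  by split=> // c x y -> ->; rewrite scaler0 addr0.
rewrite big1_seq // => -[a b] /s0 /= ->.
exact: purek0r.
Qed.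

End Slices.

Section RightSlices.
Variables (k : fieldType) (A B : lmodType k).

Definition rslice (psi : {scalar B}) : tensk A B -> A :=
  tliftk (fun a b => psi b *: a).

Lemma rslice_balanced (psi : {scalar B}) :
  balanced (fun (a : A) (c : k) => c *: a) (fun (a : A) b => psi b *: a).
Proof.
apply: balancedk => *; rewrite ?raddfD ?scalerDl ?scalerDr //.
by rewrite scalarZ scalerA mulrC.
Qed.

Lemma rslice_pure psi a b : rslice psi (purek a b) = psi b *: a.
Proof. by apply: tliftk_pure; apply: rslice_balanced. Qed.

Lemma rsliceD psi : {morph rslice psi : t u / t + u}.
Proof. by apply: tliftkD; apply: rslice_balanced. Qed.

End RightSlices.

Section Swap.
Variables (k : fieldType) (A B : lmodType k).

Definition tswap : tensk A B -> tensk B A := tliftk (fun a b => purek b a).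

Lemma tswap_balanced :
  balanced (fun (a : A) (c : k) => c *: a) (fun (a : A) (b : B) => purek b a).
Proof. by apply: balancedk => *; rewrite ?purekDl ?purekDr ?purekZ. Qed.

Lemma tswap_pure a b : tswap (purek a b) = purek b a.
Proof. by apply: tliftk_pure; apply: tswap_balanced. Qed.

Lemma tswapD : {morph tswap : t u / t + u}.
Proof. by apply: tliftkD; apply: tswap_balanced. Qed.

End Swap.

Lemma tswapK (k : fieldType) (A B : lmodType k) :
  cancel (@tswap k A B) (@tswap k B A).
Proof.
apply: tensk_ext => [||a b]; last by rewrite !tswap_pure.
  exact: add_comp_morph (@tswapD _ _ _) (@tswapD _ _ _).
by [].
Qed.

Lemma rslices_eq0 (k : fieldType) (A B : lmodType k) (t : tensk A B) :
  (forall psi, rslice psi t = 0) -> t = 0.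
Proof.
move=> t0; rewrite -[t]tswapK (_ : tswap t = 0).
  by apply: (addrI (tswap 0)); rewrite -tswapD !addr0.
apply: slices_eq0 => psi; rewrite -(t0 psi); move: t {t0}.
apply: tensk_ext => [||a b]; last by rewrite tswap_pure slice_pure rslice_pure.
  exact: add_comp_morph (@sliceD _ _ _ psi) (@tswapD _ _ _).
exact: rsliceD.
Qed.

(** * The degree defined by the coproduct *)

Section Degree.
Variables (k : fieldType) (H : bialgType k).
Implicit Types (x y : H) (phi : {scalar H}).

Definition contract phi (x : H) : H := slice phi (coprod x).

Lemma contract_linear phi : linear (contract phi).
Proof. by move=> c x y; rewrite /contract coprod_linear slice_linear. Qed.

HB.instance Definition _ phi :=
  GRing.isLinear.Build k H H _ (contract phi) (contract_linear phi).

Lemma coprodM : {morph @coprod k H : x y / x * y}.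
Proof. exact: rmorphM. Qed.

Lemma coprod1 : coprod (1 : H) = purek 1 1.
Proof. exact: rmorph1. Qed.

Lemma coprodD : {morph @coprod k H : x y / x + y}.
Proof. exact: raddfD. Qed.

Lemma coprodZ c x : coprod (c *: x) = c *: coprod x.
Proof. exact: linearZ. Qed.

(** The union over n of these subspaces is the conilpotent part of H, filtered
    by its coradical filtration. The bound n on the degree is strict, which
    leaves n = 0 for the zero element. *)
Fixpoint deglt (n : nat) (x : H) : Prop :=
  if n is m.+1 then
    forall phi : {scalar H}, phi 1 = 0 -> deglt m (contract phi x)
  else x = 0.

Lemma slice_mulr phi (t : tensk H H) y :
  slice phi (t * purek 1 y) = slice phi t * y.
Proof.
move: t; apply: tensk_ext => [t u|t u|a b].
- by rewrite mulrDl sliceD.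
- by rewrite sliceD mulrDl.
- by rewrite purekM mulr1 !slice_pure scalerAl.
Qed.

Lemma slice_mull phi x (t : tensk H H) :
  slice phi (purek 1 x * t) = x * slice phi t.
Proof.
move: t; apply: tensk_ext => [t u|t u|a b].
- by rewrite mulrDr sliceD.
- by rewrite sliceD mulrDr.
- by rewrite purekM mul1r !slice_pure scalerAr.
Qed.

Lemma deglt_subspace n : subspace (deglt n).
Proof.
elim: n => [|n [IH0 IHP]]; split=> //=.
- by move=> c x y -> ->; rewrite scaler0 addr0.
- by move=> phi _; rewrite linear0.
- move=> c x y Dx Dy phi phi1; rewrite linearP.
  by apply: IHP; [exact: Dx|exact: Dy].
Qed.

Lemma deglt0 n : deglt n 0.
Proof. by case: (deglt_subspace n). Qed.

Lemma degltS n x : deglt n x -> deglt n.+1 x.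
Proof.
elim: n x => [x ->|n IHn x Dx] /= phi phi1; first by rewrite linear0.
by apply: IHn; apply: Dx.
Qed.

Lemma deglt_le m n x : (m <= n)%N -> deglt m x -> deglt n x.
Proof. by move/subnK <-; elim: (n - m)%N => // d IHd /IHd/degltS. Qed.

Lemma deglt_contract n x phi : phi 1 = 0 -> deglt n x ->
  deglt n.-1 (contract phi x).
Proof. by case: n => [|n] /= phi1; [move->; rewrite linear0|apply]. Qed.

(** The slice of Delta(x) - 1 (x) x by phi is the contraction of x by
    phi - phi(1) epsilon, a functional that vanishes at 1. *)
Lemma coprod_deglt n x : deglt n x ->
  exists2 s : seq (H * H), (forall p, p \in s -> deglt n.-1 p.2) &
    coprod x = purek 1 x + \sum_(p <- s) purek p.1 p.2.
Proof.
case: n => [->|n Dx].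
  by exists [::] => //; rewrite big_nil addr0 purek0r raddf0.
have [|phi|s Ds Es] :=
  @slices_in_subspace k H H (deglt n) (coprod x - purek 1 x).
- exact: deglt_subspace.
- have psi_lin : scalar (fun a : H => phi a - phi 1 * augm a).
    move=> c a b; rewrite linearP augmD augmZ /=.
    by rewrite mulrDr opprD addrACA mulrBr; congr (_ - _ + _); rewrite mulrCA.
  have [psi psiE] := scalar_functional psi_lin.
  have -> : slice phi (coprod x - purek 1 x) = contract psi x.
    rewrite sliceB slice_pure -{2}(coprod_counitl x) /contract -/(counitl _).
    move: (coprod x); apply: tensk_ext => [t u|t u|a b].
    + rewrite sliceD (counitlD (H := H)) scalerDr opprD addrACA //.
    + exact: sliceD.
    + rewrite !slice_pure (counitl_pure (H := H)) psiE scalerBl scalerA //.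
  by apply: Dx; rewrite psiE augm1 mulr1 subrr.
by exists s; rewrite // -Es addrC subrK.
Qed.

(** Writing Delta(x) = 1 (x) x + t and Delta(y) = 1 (x) y + u, the deviation of
    the contraction from a derivation is the slice of t u. The subspace W is
    kept arbitrary because this precedes, and serves to prove, the bound on the
    degree of a product. *)
Lemma contractM (W : H -> Prop) phi a b x y : phi 1 = 0 -> subspace W ->
    deglt a x -> deglt b y ->
    (forall x' y', deglt a.-1 x' -> deglt b.-1 y' -> W (x' * y')) ->
  W (contract phi (x * y) - (contract phi x * y + x * contract phi y)).
Proof.
move=> phi1 Wsub /coprod_deglt[s Ds Ex] /coprod_deglt[r Dr Ey] Wxy.
rewrite /contract coprodM Ex Ey.
set t := \sum_(p <- s) _; set u := \sum_(p <- r) _.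
rewrite mulrDl !mulrDr !sliceD !slice_pure phi1 !scale0r !add0r.
rewrite purekM slice_pure mulr1 phi1 scale0r add0r slice_mull slice_mulr.
rewrite addrA [x * _ + _]addrC addrAC subrr add0r /t /u mulr_suml slice_sum.
apply: (subspace_sum Wsub) => p ps; rewrite mulr_sumr slice_sum.
apply: (subspace_sum Wsub) => q qr; rewrite purekM slice_pure.
by apply/(subspaceZ Wsub)/Wxy; [apply: Ds|apply: Dr].
Qed.

(** The bounds being strict, the degrees are at most a - 1 and b - 1, and add up
    to at most a + b - 2. *)
Lemma degltM a b x y : deglt a x -> deglt b y -> deglt (a + b).-1 (x * y).
Proof.
move: {2}(a + b)%N (leqnn (a + b)) => n.
elim: n a b x y => [|n IHn] [|a] [|b] x y le_ab Dx Dy //;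
  try by rewrite ?(Dx : x = 0) ?(Dy : y = 0) ?mul0r ?mulr0; apply: deglt0.
rewrite addnS addSn /= in le_ab * => phi phi1.
pose z := contract phi x * y + x * contract phi y.
rewrite -[contract _ _](subrK z); apply: (subspaceD (deglt_subspace _)).
  apply: (contractM phi1 (deglt_subspace _) Dx Dy) => x' y' Dx' Dy'.
  apply: deglt_le (leq_pred _) _; apply: IHn Dx' Dy'; lia.
apply: (subspaceD (deglt_subspace _)).
  rewrite -[(a + b)%N]/((a + b).+1.-1) -addnS.
  by apply: IHn (Dx _ phi1) Dy; lia.
by rewrite -[(a + b)%N]/((a + b).+1.-1) -addSn; apply: IHn Dx (Dy _ phi1); lia.
Qed.

Lemma deglt_scalar (c : k) : deglt 1 (c%:A : H).
Proof.
move=> phi phi1; rewrite /contract coprodZ coprod1 sliceZ.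
by rewrite slice_pure phi1 scale0r scaler0.
Qed.

Lemma deglt_primitive x : coprod x = purek x 1 + purek 1 x -> deglt 2 x.
Proof.
move=> Ex phi phi1; rewrite /contract Ex sliceD !slice_pure phi1 scale0r addr0.
exact: deglt_scalar.
Qed.

End Degree.

Arguments deglt_subspace {k H} n.
Arguments deglt0 {k H} n.

Lemma uea_conilpotent (k : fieldType) (L : lieAlgType k) (x : uea L) :
  exists n, deglt n x.
Proof.
elim/uea_ind: x => [x|a|x y [m Dx] [n Dy]|x y [m Dx] [n Dy]].
- by exists 2%N; apply: deglt_primitive; apply: ucoprod_gen.
- by exists 1%N; apply: deglt_scalar.
- exists (maxn m n); apply: (subspaceD (deglt_subspace _)).
    exact: deglt_le (leq_maxl _ _) Dx.
  exact: deglt_le (leq_maxr _ _) Dy.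
- by exists (m + n).-1; apply: degltM.
Qed.

(** * Leading parts do not cancel *)

Lemma subrD_cancel (V : zmodType) (a b c u v : V) :
  a - (b + c) + ((b - u) + (c - v)) = a - (u + v).
Proof. by rewrite [b - u + _]addrACA -opprD [LHS]addrA subrK. Qed.

Section Domain.
Variables (k : fieldType) (H : bialgType k).
Implicit Types (x y : H) (phi : {scalar H}).

Lemma deglt1_scalar x : deglt 1 x -> x = augm x *: 1.
Proof.
case/coprod_deglt=> s s0 Ex; rewrite -{1}(coprod_counitr x) -/(counitr _) Ex.
rewrite big1_seq ?addr0 ?counitr_pure // => p /s0 /= ->; exact: purek0r.
Qed.

Lemma deglt_iter n i x phi : phi 1 = 0 -> deglt (n + i) x ->
  deglt n (iter i (contract phi) x).
Proof.
move=> phi1; elim: i n => [|i IHi] n; rewrite ?addn0 //= addnS -addSn.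
by move/IHi/(deglt_contract phi1).
Qed.

Lemma iter_contractB i phi x y : iter i (contract phi) (x - y) =
  iter i (contract phi) x - iter i (contract phi) y.
Proof. by elim: i => //= i ->; rewrite linearB. Qed.

Lemma iter_contractD i phi x y : iter i (contract phi) (x + y) =
  iter i (contract phi) x + iter i (contract phi) y.
Proof. by elim: i => //= i ->; rewrite linearD. Qed.

Lemma deglt_contractM phi a b x y : phi 1 = 0 -> deglt a.+1 x -> deglt b.+1 y ->
  deglt (a + b).-1
    (contract phi (x * y) - (contract phi x * y + x * contract phi y)).
Proof.
move=> phi1 Dx Dy; apply: (contractM phi1 (deglt_subspace _) Dx Dy) => x' y'.
exact: degltM.
Qed.

(** Of all the terms of Leibniz' rule for the power i + j, only the one with i
    contractions on x and j on y survives: the others contract x more than i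
    times or y more than j times, which lowers their degree. *)
Lemma iter_contractM phi c d i j x y : phi 1 = 0 ->
    deglt (c + i).+1 x -> deglt (d + j).+1 y ->
    deglt c.-1 (iter i.+1 (contract phi) x) ->
    deglt d.-1 (iter j.+1 (contract phi) y) ->
  deglt (c + d) (iter (i + j) (contract phi) (x * y) -
    (iter i (contract phi) x * iter j (contract phi) y) *+ 'C(i + j, i)).
Proof.
move=> phi1.
move: {2}(i + j)%N (erefl (i + j)%N) => N.
elim: N c d i j x y => [|N IHN] c d i j x y ijN Dx Dy Lx Ly.
  have [-> ->] : i = 0%N /\ j = 0%N by lia.
  by rewrite /= bin0 mulr1n subrr; apply: deglt0.
(* The pairs (L x, y) and (x, L y), for L = contract phi, feed the two terms of
   Pascal's rule; if i = 0 or j = 0 the corresponding term has low degree. *)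
have Dl : deglt (c + d) (iter N (contract phi) (contract phi x * y) -
    (iter i (contract phi) x * iter j (contract phi) y) *+
      (if i is i'.+1 then 'C(N, i') else 0)).
  case: i ijN Dx Lx => [|i] ijN Dx Lx.
    rewrite mulr0n subr0; apply: deglt_iter => //.
    case: c Dx Lx => [|c] Dx Lx.
      by rewrite [contract phi x]Lx mul0r; apply: deglt0.
    rewrite (_ : (c.+1 + d + N)%N = (c + (d + j).+1).-1)%N; last by lia.
    exact: degltM.
  have -> : N = (i + j)%N by lia.
  rewrite iterSr.
  apply: IHN; rewrite -?iterSr //; first by lia.
  by have := deglt_contract phi1 Dx; rewrite addnS.
have Dr : deglt (c + d) (iter N (contract phi) (x * contract phi y) -
    (iter i (contract phi) x * iter j (contract phi) y) *+
      (if j is j'.+1 then 'C(N, i) else 0)).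
  case: j ijN Dy Ly {Dl} => [|j] ijN Dy Ly.
    rewrite mulr0n subr0; apply: deglt_iter => //.
    case: d Dy Ly => [|d] Dy Ly.
      by rewrite [contract phi y]Ly mulr0; apply: deglt0.
    rewrite (_ : (c + d.+1 + N)%N = ((c + i).+1 + d).-1)%N; last by lia.
    exact: degltM.
  have -> : N = (i + j)%N by lia.
  rewrite [iter j.+1 _ _]iterSr.
  apply: IHN; rewrite -?iterSr //; first by lia.
  by have := deglt_contract phi1 Dy; rewrite addnS.
have -> : 'C(i + j, i) = ((if i is i'.+1 then 'C(N, i') else 0) +
    (if j is j'.+1 then 'C(N, i) else 0))%N.
  rewrite ijN; case: i j ijN {Dx Dy Lx Ly Dl Dr} => [|i] [|j] ijN //.
  - by rewrite !bin0.
  - by (have -> : N = i by lia); rewrite !binn.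
  - by rewrite binS addnC.
rewrite ijN iterSr.
have DL : deglt (c + d) (iter N (contract phi)
    (contract phi (x * y) - (contract phi x * y + x * contract phi y))).
  apply: deglt_iter => //; apply: deglt_le (deglt_contractM phi1 Dx Dy); lia.
have := subspaceD (deglt_subspace _) DL (subspaceD (deglt_subspace _) Dl Dr).
rewrite iter_contractB iter_contractD mulrnDr.
by rewrite subrD_cancel.
Qed.

(** Here i is the number of contractions by phi after which the degree has
    dropped by exactly i while the next contraction lowers it by more than 1.
    It exists because the degree cannot drop below 0. *)
Lemma iter_contract_max phi a x : phi 1 = 0 -> deglt a.+1 x -> ~ deglt a x ->
  exists i c, [/\ a = (c + i)%N, ~ deglt c (iter i (contract phi) x),
    deglt c.-1 (iter i.+1 (contract phi) x) &
    ~ deglt a.-1 (contract phi x) -> (0 < i)%N].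
Proof.
move=> phi1; elim: a x => [|a IHa] x Dx nDx.
  by exists 0%N, 0%N; split=> //; [exact: (deglt_contract phi1 Dx)|
    case; exact: (deglt_contract phi1 Dx)].
have [DL|nDL] := EM (deglt a (contract phi x)).
  by exists 0%N, a.+1; split=> //; rewrite addn0.
have [i [c [-> nD DS _]]] := IHa _ (deglt_contract phi1 Dx) nDL.
by exists i.+1, c; rewrite addnS; split=> //; rewrite iterSr.
Qed.

Lemma exists_contract a x : ~ deglt a.+1 x ->
  exists2 phi : {scalar H}, phi 1 = 0 & ~ deglt a (contract phi x).
Proof.
move=> nDx; apply: contrapT => nphi; apply: nDx => phi phi1.
by apply: contrapT => nD; apply: nphi; exists phi.
Qed.

(** Induction on a + b: contracting x and y as in [iter_contract_max], along a
    phi that lowers the degree of one of them by 1 only, replaces them by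
    elements of smaller total degree whose product is, up to the factor
    'C(i + j, i) and lower terms, an iterated contraction of x y. *)
Lemma degltM_sharp a b x y : [pchar k] =i pred0 ->
  deglt a.+1 x -> ~ deglt a x ->
  deglt b.+1 y -> ~ deglt b y -> ~ deglt (a + b) (x * y).
Proof.
move=> char0; move: {2}(a + b)%N (leqnn (a + b)) => n.
elim: n a b x y => [|n IHn] a b x y le_ab Dx nDx Dy nDy.
  have [a0 b0] : a = 0%N /\ b = 0%N by lia.
  rewrite {}a0 {}b0 {le_ab} in Dx nDx Dy nDy *.
  rewrite (deglt1_scalar Dx) (deglt1_scalar Dy) in nDx nDy * => /=.
  rewrite -scalerAl mul1r scalerA => /eqP.
  rewrite scaler_eq0 oner_eq0 orbF mulf_eq0.
  by case/orP=> /eqP e0; [apply: nDx|apply: nDy]; rewrite e0 scale0r.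
have [ab0|ab_gt0] := leqP (a + b) 0; first by apply: IHn => //; lia.
have [phi phi1 nLxy] : exists2 phi : {scalar H}, phi 1 = 0 &
    ~ (deglt a.-1 (contract phi x) /\ deglt b.-1 (contract phi y)).
  case: a b Dx nDx Dy nDy ab_gt0 {le_ab} => [|a] [|b] // Dx nDx Dy nDy _.
  - by have [phi phi1 nL] := exists_contract nDy; exists phi => // -[].
  - by have [phi phi1 nL] := exists_contract nDx; exists phi => // -[].
  - by have [phi phi1 nL] := exists_contract nDx; exists phi => // -[].
have [i [c [aE nDi Di i0]]] := iter_contract_max phi1 Dx nDx.
have [j [d [bE nDj Dj j0]]] := iter_contract_max phi1 Dy nDy.
have ij_gt0 : (0 < i + j)%N.
  rewrite addn_gt0; apply/orP; apply: contrapT => /not_orP[/negP ni /negP nj].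
  apply: nLxy; split; apply: contrapT; first by move/i0; apply/negP.
  by move/j0; apply/negP.
rewrite aE in Dx; rewrite bE in Dy => Dxy.
have := iter_contractM phi1 Dx Dy Di Dj.
have : deglt (c + d) (iter (i + j) (contract phi) (x * y)).
  by apply: deglt_iter => //; rewrite addnACA -aE -bE.
move=> D1 D2; have := subspaceB (deglt_subspace _) D1 D2.
rewrite opprB addrC subrK.
rewrite -scaler_nat => /(subspaceZ (deglt_subspace _) ('C(i + j, i)%:R^-1)).
rewrite scalerA mulVf ?scale1r; last first.
  by rewrite ((pcharf0P k).1 char0) -lt0n bin_gt0 leq_addr.
apply: IHn => //; first by lia.
  by apply: deglt_iter => //; rewrite addSn.
by apply: deglt_iter => //; rewrite addSn.
Qed.

End Domain.

(** * Zero divisors in the tensor square *)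

Section ZeroDivisors.
Variables (k : fieldType) (H : bialgType k).
Hypothesis char0 : [pchar k] =i pred0.
Hypothesis conilpotent : forall x : H, exists n, deglt n x.
Local Notation HH := (tensk H H).

Lemma exact_degree (x : H) : x <> 0 -> exists n, deglt n.+1 x /\ ~ deglt n x.
Proof.
have [n] := conilpotent x; elim: n => [//|n IHn] Dx x0.
by have [/IHn/(_ x0)//|nDx] := EM (deglt n x); exists n.
Qed.

Lemma tens_exact_degree (t : HH) : t <> 0 -> exists n (phi : {scalar H}),
  (forall psi : {scalar H}, deglt n.+1 (slice psi t)) /\
  ~ deglt n (slice phi t).
Proof.
move=> t0; have [n] : exists n, forall psi : {scalar H}, deglt n (slice psi t).
  have [s ->] := tensk_sum t.
  have [f fP] := choice conilpotent.
  exists (\max_(p <- s) f p.2)%N => psi; rewrite slice_sum.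
  apply: (subspace_sum (deglt_subspace _)) => p ps; rewrite slice_pure.
  apply/(subspaceZ (deglt_subspace _))/(deglt_le _ (fP p.2)).
  exact: (@leq_bigmax_seq _ s xpredT (fun p : H * H => f p.2)).
elim: n => [/slices_eq0//|n IHn] Dt.
have [Dn|nDn] := EM (forall psi : {scalar H}, deglt n (slice psi t)).
  exact: IHn.
by move/existsNP: nDn => [phi nD]; exists n, phi.
Qed.

(** When (phi (x) id)(t) has the largest degree among all slices of t, slicing
    t Delta(x) by phi turns the part 1 (x) x of Delta(x) into the product of
    (phi (x) id)(t) and x, and the rest of Delta(x) into terms of smaller
    degree. *)
Lemma mul_coprod_eq0 (t : HH) (x : H) : t * coprod x = 0 -> t <> 0 -> x = 0.
Proof.
move=> tx t0; apply: contrapT => /exact_degree[b [Dx nDx]].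
have [a [phi [Dt nDt]]] := tens_exact_degree t0.
apply: (degltM_sharp char0 (Dt phi) nDt Dx nDx).
have [s Ds Et] := slices_in_subspace (deglt_subspace _) Dt.
have [r Dr Ex] := coprod_deglt Dx.
have /(congr1 (slice phi)) := tx; rewrite Ex mulrDr sliceD slice_mulr raddf0.
move/(canRL (addrK _)) => ->; rewrite sub0r -scaleN1r.
apply/(subspaceZ (deglt_subspace _)); rewrite {1}Et mulr_suml slice_sum.
apply: (subspace_sum (deglt_subspace _)) => p ps; rewrite mulr_sumr slice_sum.
apply: (subspace_sum (deglt_subspace _)) => q qr; rewrite purekM slice_pure.
apply/(subspaceZ (deglt_subspace _)).
exact: (degltM (Ds _ ps) (Dr _ qr)).
Qed.

Lemma rslice_coprod_l (psi : {scalar H}) (t u : HH) :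
  rslice psi (purek t 1 * coprod_l u) = t * coprod (rslice psi u).
Proof.
move: u; apply: tensk_ext => [u v|u v|a b].
- by rewrite coprod_lD mulrDr rsliceD.
- by rewrite rsliceD coprodD mulrDr.
- by rewrite coprod_l_pure purekM mul1r !rslice_pure coprodZ scalerAr.
Qed.

Lemma coprod_l_self_eq0 (t : HH) : purek t 1 * coprod_l t = 0 -> t = 0.
Proof.
move=> tt; have [//|t0] := EM (t = 0); apply: rslices_eq0 => psi.
apply: mul_coprod_eq0 t0; rewrite -rslice_coprod_l tt.
by apply: (addrI (rslice psi 0)); rewrite -rsliceD !addr0.
Qed.

(** H^(x)3 being associated to the left, slicing its first factor means slicing
    inside the first of two factors. *)
Definition slice3 (phi : {scalar H}) : tensk HH H -> HH :=
  tmap (slice phi) idfun.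

Lemma slice3D phi : {morph slice3 phi : t u / t + u}.
Proof. exact: (tmapD (slice phi) idfun). Qed.

Lemma slice3_tassoc (phi : {scalar H}) (a : H) (t : HH) :
  slice3 phi (tassoc (purek a t)) = phi a *: t.
Proof.
move: t; apply: tensk_ext => [u v|u v|b c].
- apply: (etrans _ (slice3D _ _ _)); congr (slice3 _ _).
  by apply: (etrans _ (tassocD _ _)); congr (tassoc _); apply: purekDr.
- exact: scalerDr.
- rewrite tassoc_pure scale_purek -slice_pure.
  exact: (tmap_pure (slice phi) idfun).
Qed.

Lemma tassocM_pure (t u : HH) (a : H) :
  tassoc (purek 1 t) * tassoc (purek a u) = tassoc (purek a (t * u)).
Proof.
apply: (etrans (esym (tassocM _ _))); congr (tassoc _).
by apply: (etrans (@purekM k H HH _ _ _ _)); rewrite mul1r.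
Qed.

Lemma slice3_coprod_r (phi : {scalar H}) (t u : HH) :
  slice3 phi (tassoc (purek 1 t) * coprod_r u) = t * coprod (slice phi u).
Proof.
move: u; apply: tensk_ext => [u v|u v|a b].
- by rewrite coprod_rD mulrDr slice3D.
- by rewrite sliceD coprodD mulrDr.
- rewrite coprod_r_pure tassocM_pure slice3_tassoc slice_pure.
  by rewrite coprodZ scalerAr.
Qed.

Lemma coprod_r_self_eq0 (t : HH) : tassoc (purek 1 t) * coprod_r t = 0 -> t = 0.
Proof.
move=> tt; have [//|t0] := EM (t = 0); apply: slices_eq0 => phi.
apply: mul_coprod_eq0 t0; rewrite -slice3_coprod_r tt.
by apply: (addrI (slice3 phi 0)); rewrite -slice3D !addr0.
Qed.

End ZeroDivisors.

(** * Free modules of rank two *)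

Section RankTwo.
Variables (k : fieldType) (H : bialgType k) (A : lmodType H) (e1 e2 : A).
Hypothesis basis : is_basis2 e1 e2.

Lemma is_basis2_coords : exists c1 c2 : {linear A -> H | *%R},
  [/\ forall x, x = c1 x *: e1 + c2 x *: e2,
      c1 e1 = 1, c1 e2 = 0, c2 e1 = 0 & c2 e2 = 1].
Proof.
have [c cP] := choice basis.
have cE x : x = (c x).1 *: e1 + (c x).2 *: e2 by case: (cP x).
have cU x h g : x = h *: e1 + g *: e2 -> c x = (h, g).
  by move=> Ex; case: (cP x) => _; apply.
have c_lin a x y :
    c (a *: x + y) = (a * (c x).1 + (c y).1, a * (c x).2 + (c y).2).
  apply: cU; rewrite [in LHS](cE x) [in LHS](cE y) scalerDr !scalerA addrACA.
  by rewrite -!scalerDl.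
have c1_lin : linear_for *%R (fun x => (c x).1) by move=> a x y; rewrite c_lin.
have c2_lin : linear_for *%R (fun x => (c x).2) by move=> a x y; rewrite c_lin.
pose l1 := GRing.isLinear.Build _ _ _ _ _ c1_lin.
pose l2 := GRing.isLinear.Build _ _ _ _ _ c2_lin.
pose c1 : {linear A -> H | *%R} := HB.pack (fun x => (c x).1) l1.
pose c2 : {linear A -> H | *%R} := HB.pack (fun x => (c x).2) l2.
have ce1 : c e1 = (1, 0) by apply: cU; rewrite scale1r scale0r addr0.
have ce2 : c e2 = (0, 1) by apply: cU; rewrite scale1r scale0r add0r.
by exists c1, c2; split; rewrite //= ?ce1 ?ce2.
Qed.

Lemma pure2Dl u v (x : A) : pure2 (u + v) x = pure2 u x + pure2 v x.
Proof. exact: pureDl. Qed.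

Lemma pure2Dr u (x y : A) : pure2 u (x + y) = pure2 u x + pure2 u y.
Proof. exact: pureDr. Qed.

Lemma pure2_bal u h (x : A) : pure2 (u * coprod h) x = pure2 u (h *: x).
Proof. exact: (pure_bal (@act2 k H)). Qed.

Lemma pure2_0l (x : A) : pure2 0 x = 0.
Proof. by apply: (addrI (pure2 0 x)); rewrite -pure2Dl !addr0. Qed.

Lemma tens2_basis (t : tens2 A) : exists a b : tensk H H,
  t = pure2 a e1 + pure2 b e2.
Proof.
have [c1 [c2 [cE _ _ _ _]]] := is_basis2_coords.
have [s ->] : exists s : seq (tensk H H * A), t = \sum_(p <- s) pure2 p.1 p.2.
  by exists (repr t); apply: tensE.
exists (\sum_(p <- s) p.1 * coprod (c1 p.2)).
exists (\sum_(p <- s) p.1 * coprod (c2 p.2)).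
elim: s => [|[u x] s IHs]; first by rewrite !big_nil !pure2_0l addr0.
rewrite !big_cons {}IHs !pure2Dl addrACA; congr (_ + _).
by rewrite [in LHS](cE x) pure2Dr -!pure2_bal.
Qed.

(** The identification of H^(x)3 (x)_H H with H^(x)3, precomposed with the
    H-linear coordinate c. *)
Definition coord3 (c : {linear A -> H | *%R}) :
    tens3 A -> tensk (tensk H H) H :=
  tlift (fun u x => u * coprod_l (coprod (c x))).

Lemma coord3_balanced (c : {linear A -> H | *%R}) :
  balanced (@act3 k H) (fun u x => u * coprod_l (coprod (c x))).
Proof.
split=> [u v x|u x y|u h x].
- by rewrite mulrDl.
- by rewrite (raddfD c) coprodD coprod_lD mulrDr.
- by rewrite (linearZ_LR c) coprodM coprod_lM mulrA.
Qed.

Lemma coord3_pure c u x :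
  coord3 c (pure3 u x) = u * coprod_l (coprod (c x)).
Proof. exact: (tlift_pure (coord3_balanced c)). Qed.

Lemma coord3D c : {morph coord3 c : t u / t + u}.
Proof. move=> t u; apply: tliftD; exact: coord3_balanced. Qed.

Lemma pure3_basis_eq0 u v : pure3 u e1 + pure3 v e2 = 0 :> tens3 A ->
  u = 0 /\ v = 0.
Proof.
have [c1 [c2 [_ c11 c12 c21 c22]]] := is_basis2_coords.
have c0 c : coord3 c 0 = 0.
  by apply: (addrI (coord3 c 0)); rewrite -coord3D !addr0.
have coprod3_1 : coprod_l (coprod (1 : H)) = 1.
  by rewrite coprod1 coprod_l_pure coprod1.
have coprod3_0 : coprod_l (coprod (0 : H)) = 0.
  by rewrite raddf0; apply: (addrI (coprod_l 0)); rewrite -coprod_lD !addr0.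
move=> E; split.
  have := congr1 (coord3 c1) E; rewrite c0 coord3D !coord3_pure c11 c12.
  by rewrite coprod3_1 coprod3_0 mulr1 mulr0 addr0.
have := congr1 (coord3 c2) E; rewrite c0 coord3D !coord3_pure c21 c22.
by rewrite coprod3_1 coprod3_0 mulr1 mulr0 add0r.
Qed.

End RankTwo.

Lemma is_basis2_sym (k : fieldType) (H : bialgType k) (A : lmodType H)
  (e1 e2 : A) : is_basis2 e1 e2 -> is_basis2 e2 e1.
Proof.
move=> basis x; have [[h g] [/= -> U]] := basis x; exists (g, h).
split=> [|[h' g'] /= E]; first exact: addrC.
by have [-> ->] : (h, g) = (g', h') by apply: U; rewrite E addrC.
Qed.

(** * Associativity *)

Section Associativity.
Variables (k : fieldType) (H : bialgType k) (A : lmodType H).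
Variables (pp : A -> A -> tens2 A) (ppP : pseudoproduct pp).

Lemma coprod_lA0 : coprod_lA (0 : tens2 A) = 0.
Proof. by apply: (addrI (coprod_lA 0)); rewrite -coprod_lAD !addr0. Qed.

Lemma coprod_rA0 : coprod_rA (0 : tens2 A) = 0.
Proof. by apply: (addrI (coprod_rA 0)); rewrite -coprod_rAD !addr0. Qed.

Lemma lmul30 b : lmul3 b (0 : tens3 A) = 0.
Proof. by apply: (addrI (lmul3 b 0)); rewrite -lmul3D !addr0. Qed.

Lemma lmul20 b : lmul2 b (0 : tens2 A) = 0.
Proof. by apply: (addrI (lmul2 b 0)); rewrite -lmul2D !addr0. Qed.

Lemma ppl0 y : ppl pp 0 y = 0.
Proof. by apply: (addrI (ppl pp 0 y)); rewrite -(pplD ppP) !addr0. Qed.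

Lemma ppr0 x : ppr pp x 0 = 0.
Proof. by apply: (addrI (ppr pp x 0)); rewrite -(pprD ppP) !addr0. Qed.

Lemma associative_cross_product_eq0 (e1 e2 : A) :
    [pchar k] =i pred0 -> (forall x : H, exists n, deglt n x) ->
    is_basis2 e1 e2 -> pp e1 e1 = 0 -> pp e2 e2 = 0 ->
  pseudo_associative pp -> pp e1 e2 = 0.
Proof.
move=> char0 conil basis e11 e22 assoc.
have [a [b E]] := tens2_basis basis (pp e1 e2).
have a0 : a = 0.
  apply: (coprod_l_self_eq0 char0 conil).
  have := assoc e1 e2 e2; rewrite e22 ppr0 [in LHS]E (pplD ppP) !(ppl_pure ppP).
  rewrite e22 E coprod_lA0 lmul30 addr0 coprod_lAD lmul3D !coprod_lA_pure.
  by rewrite !lmul3_pure => /(pure3_basis_eq0 basis)[].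
have b0 : b = 0.
  apply: (coprod_r_self_eq0 char0 conil).
  have := assoc e1 e1 e2; rewrite e11 ppl0 [in RHS]E (pprD ppP) !(ppr_pure ppP).
  rewrite e11 E coprod_rA0 lmul30 add0r coprod_rAD lmul3D !coprod_rA_pure.
  by rewrite !lmul3_pure => /esym/(pure3_basis_eq0 basis)[].
by rewrite E a0 b0 !pure2_0l addr0.
Qed.

Lemma pseudoproduct_eq0 (e1 e2 : A) : is_basis2 e1 e2 ->
    pp e1 e1 = 0 -> pp e1 e2 = 0 -> pp e2 e1 = 0 -> pp e2 e2 = 0 ->
  forall x y, pp x y = 0.
Proof.
case: ppP => Dl Dr Hl basis e11 e12 e21 e22 x y.
have [[h g] [/= -> _]] := basis x; have [[h' g'] [/= -> _]] := basis y.
by rewrite Dl !Dr !Hl e11 e12 e21 e22 !lmul20 !addr0.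
Qed.

End Associativity.

Theorem theorem4p2 (k : closedFieldType) (char0 : [pchar k] =i pred0)
    (delta : lieAlgType k) (P : lmodType (uea delta)) (e1 e2 : P)
    (basis : is_basis2 e1 e2)
    (pp : P -> P -> tens2 P) (ppP : pseudoproduct pp)
    (e11 : pp e1 e1 = 0) (e22 : pp e2 e2 = 0) :
  pseudo_associative pp <-> pp e1 e2 = 0 /\ pp e2 e1 = 0.
Proof.
split=> [assoc|[e12 e21] x y z].
  have conil (x : uea delta) : exists n, deglt n x by apply: uea_conilpotent.
  split; first exact: (associative_cross_product_eq0 ppP char0 conil basis).
  exact: (associative_cross_product_eq0 ppP char0 conil (is_basis2_sym basis)).
have pp0 := pseudoproduct_eq0 ppP basis e11 e12 e21 e22.
by rewrite (pp0 x y) (pp0 y z) (ppl0 ppP) (ppr0 ppP).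
Qed.
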